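(* Let $R$ be a commutative Noetherian ring, $F$ and $G$ free $R$-modules of rank $\mathfrak f$ and $\mathfrak g$, respectively, with $\mathfrak g\le \mathfrak f$, and let $\Phi:G^*\to F$ be an $R$-module homomorphism. Let $i$ and $a$ be integers with $1\le a\le \mathfrak g$, and let $\mathcal C^{i,a}_\Phi$ be the complex described in the context. If $-1\le i\le \mathfrak f-\mathfrak g$, then $$H_j(\mathcal C^{i,a}_\Phi)=0\quad\text{for}\quad \mathfrak f-\mathfrak g+2-\operatorname{grade} I_{\mathfrak g}(\Phi)\le j.$$
   Context: Conventions. All functors $\otimes$, $\operatorname{Hom}$, $(-)^*=\operatorname{Hom}_R(-,R)$, $\operatorname{Sym}_i$, $D_i$ (divided powers), $\bigwedge^i$ are over $R$ and vanish in negative degree. For a finite rank free module $V$, $D_\bullet(V^* )$ is a module over $\operatorname{Sym}_\bullet V$ (and $D_\bullet V$ over $\operatorname{Sym}_\bullet(V^* )$), and $\bigwedge^\bullet V$, $\bigwedge^\bullet(V^* )$ are modules over one another, in the usual way (contraction); the action of $u$ on $v$ is written $u(v)$. Schur and Weyl modules of hooks. For $V$ free of finite rank with basis $\{n_\ell\}$ and dual basis $\{n_\ell^*\}$ of $V^*$, and integers $p,q$, let $\kappa:\bigwedge^pV\otimes \operatorname{Sym}_qV\to\bigwedge^{p-1}V\otimes \operatorname{Sym}_{q+1}V$, $\kappa(x\otimes y)=\sum_\ell n_\ell^*(x)\otimes n_\ell y$, and $\eta:\bigwedge^pV\otimes D_qV\to\bigwedge^{p+1}V\otimes D_{q-1}V$,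 $\eta(x\otimes y)=\sum_\ell x\wedge n_\ell\otimes n_\ell^*(y)$. Set $L^p_qV=\ker\kappa\subseteq\bigwedge^pV\otimes \operatorname{Sym}_qV$ and $K^p_qV=\ker\eta\subseteq\bigwedge^pV\otimes D_qV$. (In particular $K^p_0V=\bigwedge^pV$.) Maps. With $\{n_\ell\}$ a basis of $G$ and $\{n_\ell^*\}$ the dual basis of $G^*$, the assignments $\eta_\Phi(f\otimes x\otimes y)=\sum_\ell f\wedge\Phi(n_\ell^* )\otimes x\otimes n_\ell(y)$ and $\operatorname{Kos}_\Phi(f\otimes x\otimes y)=\sum_\ell f\wedge\Phi(n_\ell^* )\otimes x\otimes n_\ell y$ induce maps $\eta_\Phi:\bigwedge^rF\otimes K^p_q(G^* )\to\bigwedge^{r+1}F\otimes K^p_{q-1}(G^* )$ and $\operatorname{Kos}_\Phi:\bigwedge^rF\otimes L^p_qG\to\bigwedge^{r+1}F\otimes L^p_{q+1}G$. The complex $\mathcal C^{i,a}_\Phi$ ($i,a$ integers, $1\le a\le\mathfrak g$) has modules $$(\mathcal C^{i,a}_\Phi)_j=\begin{cases}\bigwedge^{\mathfrak f-j}F\otimes L_{i+1-j}^{\mathfrak g-a}G,&j\le i,\\ \bigwedge^{\mathfrak f-\mathfrak g+a-i-1}F,&j=i+1,\\ \bigwedge^{\mathfrak f-\mathfrak g+1-j}F\otimes K_{j-i-2}^{a}(G^* ),&i+2\le j,\end{cases}$$ and differentials $d_j:(\mathcal C^{i,a}_\Phi)_j\to(\mathcal C^{i,a}_\Phi)_{j-1}$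 given by $d_j=\eta_\Phi$ for $j\ge i+3$; $d_{i+2}(f\otimes\gamma)=f\wedge(\bigwedge^a\Phi)(\gamma)$ for $f\in\bigwedge^{\mathfrak f-\mathfrak g-i-1}F$, $\gamma\in\bigwedge^a(G^* )=K^a_0(G^* )$; $d_{i+1}(f)=\sum_\ell f\wedge(\bigwedge^{\mathfrak g+1-a}\Phi)(m_\ell^* )\otimes\kappa(m_\ell)$, where $\{m_\ell\}$ is a basis of $\bigwedge^{\mathfrak g+1-a}G$, $\{m^*_\ell\}$ is the dual basis of $\bigwedge^{\mathfrak g+1-a}(G^* )$, and $\kappa(m_\ell)\in L_1^{\mathfrak g-a}G$; and $d_j=\operatorname{Kos}_\Phi$ for $j\le i$. Terminology. $I_{\mathfrak g}(\Phi)$ is the ideal generated by the $\mathfrak g\times\mathfrak g$ minors of a matrix of $\Phi$. The grade of a proper ideal is the length of a maximal regular sequence in it; the unit ideal has infinite grade. *)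

(* Defs.v *)
From HB Require Import structures.
From mathcomp Require Import all_boot all_order all_algebra.
From mathcomp Require Import mpoly.

Set Implicit Arguments.
Unset Strict Implicit.
Unset Printing Implicit Defensive.

Import Order.TTheory GRing.Theory Num.Theory.
Local Open Scope ring_scope.

Section Ideals.
Variable R : comNzRingType.
Implicit Types (I X : R -> Prop) (s : seq R) (x y c : R).

Definition is_ideal I : Prop :=
  [/\ I 0, forall x y, I x -> I y -> I (x + y) & forall c x, I x -> I (c * x)].

Definition ideal_gen X x : Prop :=
  exists2 cs : seq (R * R),
    forall p, p \in cs -> X p.2 & x = \sum_(p <- cs) p.1 * p.2.

Definition seq_ideal s : R -> Prop := ideal_gen (fun x => x \in s).

Definition noetherian : Prop :=
  forall I, is_ideal I -> exists s, forall x, I x <-> seq_ideal s x.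

Definition regular_seq s : Prop :=
  (forall k, (k < size s)%N -> forall y,
     seq_ideal (take k s) (s`_k * y) -> seq_ideal (take k s) y)
  /\ ~ seq_ideal s 1.

Definition maximal_regular_seq_in I s : Prop :=
  [/\ forall x, x \in s -> I x, regular_seq s
    & forall x, I x -> ~ regular_seq (rcons s x)].

(* [None] stands for infinite grade. Over a Noetherian ring all maximal
   regular sequences in a proper ideal have the same length, so this relation
   is functional in the grade. *)
Inductive has_grade I : option nat -> Prop :=
| GradeProper s : ~ I 1 -> maximal_regular_seq_in I s -> has_grade I (Some (size s))
| GradeUnit : I 1 -> has_grade I None.

Definition is_minor (k m n : nat) (A : 'M[R]_(m, n)) x : Prop :=
  exists (p : 'I_k -> 'I_m) (q : 'I_k -> 'I_n),
    [/\ {homo p : u v / (u < v)%N}, {homo q : u v / (u < v)%N}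
      & x = \det (mxsub p q A)].

Definition minors_ideal (k m n : nat) (A : 'M[R]_(m, n)) : R -> Prop :=
  ideal_gen (is_minor k A).

End Ideals.

(* For V free with an ordered basis (v_k)_{k < n} and M an R-module,
   [ext n M] is /\V (x) M: the value of x at S is the coefficient in M of
   v_S = v_{k_1} /\ .. /\ v_{k_p}, where S = {k_1 < .. < k_p}.
   In particular [ext n R^o] is /\V. *)
Notation ext n M := {ffun {set 'I_n} -> M}.

Section Exterior.
Variables (R : comNzRingType) (n : nat).

Section Module.
Variable M : lmodType R.

(* The submodule /\^p V (x) N, which is zero when p < 0. *)
Definition ext_part (p : int) (N : M -> Prop) (x : ext n M) : Prop :=
  forall S : {set 'I_n}, if #|S|%:Z == p then N (x S) else x S = 0.

(* v_A /\ v_B = (-1)^(inversions A B) v_(A :|: B) for disjoint A and B. *)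
Definition inversions (A B : {set 'I_n}) : nat :=
  #|[set ab in setX A B | (ab.2 < ab.1)%N]|.

(* (u (x) m) /\ w = (u /\ w) (x) m. *)
Definition wedge (x : ext n M) (w : ext n R^o) : ext n M :=
  [ffun S : {set 'I_n} => \sum_(A in powerset S)
     ((-1) ^+ inversions A (S :\: A) * w (S :\: A)) *: x A].

(* Contraction by the k-th dual basis vector v_k^* as a left antiderivation:
   v_k^*(u_1 /\ .. /\ u_p)
     = \sum_s (-1)^(s-1) v_k^*(u_s) u_1 /\ .. (omit u_s) .. /\ u_p. *)
Definition contract (k : 'I_n) (x : ext n M) : ext n M :=
  [ffun S : {set 'I_n} => if k \in S then 0
             else (-1) ^+ #|[set t in S | (t < k)%N]| *: x (k |: S)].

Definition tens (x : ext n R^o) (m : M) : ext n M := [ffun S => x S *: m].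

End Module.

Definition ext_basis (S : {set 'I_n}) : ext n R^o := [ffun T => (T == S)%:R].

Definition ext_vect (c : 'I_n -> R) : ext n R^o :=
  \sum_k c k *: ext_basis [set k].

Definition ext_map (M N : lmodType R) (h : M -> N) (x : ext n M) : ext n N :=
  [ffun S => h (x S)].

End Exterior.

Section Hooks.
Variables (R : comNzRingType) (n : nat).

(* {mpoly R[n]} serves both as Sym V, with 'X_[m] the monomial v^m, and as the
   underlying module of the divided power algebra D V, with 'X_[m] then standing
   for the divided monomial v^(m) = v_0^(m_0) .. v_(n-1)^(m_(n-1)); the
   polynomial product is never used on D V. *)
Definition degree_part (q : int) (y : {mpoly R[n]}) : Prop :=
  match q with Posz d => y \is d.-homog | Negz _ => y = 0 end.

Definition sym_mul (k : 'I_n) (y : {mpoly R[n]}) : {mpoly R[n]} := 'X_k * y.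

(* The action of the k-th dual basis vector on D V:
   v_k^*(v^(m)) is v^(m - U_k) if m_k > 0, and 0 otherwise. *)
Definition div_contract (k : 'I_n) (y : {mpoly R[n]}) : {mpoly R[n]} :=
  \sum_(m <- msupp y | (0 < m k)%N) y@_m *: 'X_[(m - U_(k))%MM].

Definition kappa (z : ext n {mpoly R[n]}) : ext n {mpoly R[n]} :=
  \sum_k ext_map (sym_mul k) (contract k z).

Definition eta (z : ext n {mpoly R[n]}) : ext n {mpoly R[n]} :=
  \sum_k wedge (ext_map (div_contract k) z) (ext_basis R [set k]).

(* L^p_q V and K^p_q V. *)
Definition hookL (p q : int) (z : ext n {mpoly R[n]}) : Prop :=
  ext_part p (degree_part q) z /\ kappa z = 0.

Definition hookK (p q : int) (z : ext n {mpoly R[n]}) : Prop :=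
  ext_part p (degree_part q) z /\ eta z = 0.

End Hooks.

(* The matrix A has the coordinates of Phi(n_l^* ) as its l-th column. For the
   [low] terms [ext g {mpoly R[g]}] is /\G (x) Sym G in the basis (n_l), and for
   the [high] ones it is /\G^* (x) D(G^* ) in the dual basis, so that
   [div_contract l] is the action of n_l on D(G^* ). *)
Section HookComplex.
Variables (R : comNzRingType) (f g : nat) (A : 'M[R]_(f, g)).

Definition Phi_basis (l : 'I_g) : ext f R^o := ext_vect (fun k => A k l).

(* (/\^p Phi)(n_T^* ) for p = #|T|; [enum T] is increasing. *)
Definition ext_Phi (T : {set 'I_g}) : ext f R^o :=
  \big[@wedge R f R^o/ext_basis R set0]_(l <- enum T) Phi_basis l.

Definition Kos_Phi (z : ext f (ext g {mpoly R[g]})) : ext f (ext g {mpoly R[g]}) :=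
  \sum_l wedge (ext_map (ext_map (@sym_mul R g l)) z) (Phi_basis l).

Definition eta_Phi (z : ext f (ext g {mpoly R[g]})) : ext f (ext g {mpoly R[g]}) :=
  \sum_l wedge (ext_map (ext_map (@div_contract R g l)) z) (Phi_basis l).

(* d_{i+1}; the m_l are the n_T with #|T| = g + 1 - a. *)
Definition d_mid_low (a : int) (x : ext f R^o) : ext f (ext g {mpoly R[g]}) :=
  \sum_(T : {set 'I_g} | #|T|%:Z == g%:Z + 1 - a)
     tens (wedge x (ext_Phi T)) (kappa (tens (ext_basis R T) 1)).

(* d_{i+2}; the coefficient at 0 identifies D_0(G^* ) with R. *)
Definition d_high_mid (z : ext f (ext g {mpoly R[g]})) : ext f R^o :=
  \sum_(T : {set 'I_g}) wedge ([ffun S => (z S T)@_(0%MM)] : ext f R^o) (ext_Phi T).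

Variant zone := low | mid | high.

Definition zone_of (i j : int) : zone :=
  if j <= i then low else if j == i + 1 then mid else high.

Definition ambient (s : zone) : lmodType R :=
  match s with
  | mid => ext f R^o
  | low | high => ext f (ext g {mpoly R[g]})
  end.

(* The module in position j, as a submodule of the ambient module. *)
Definition hook_term (i a j : int) : ambient (zone_of i j) -> Prop :=
  match zone_of i j as s return ambient s -> Prop with
  | low => ext_part (f%:Z - j) (hookL (g%:Z - a) (i + 1 - j))
  | mid => ext_part (f%:Z - g%:Z + a - i - 1) (fun _ : R^o => True)
  | high => ext_part (f%:Z - g%:Z + 1 - j) (hookK a (j - i - 2))
  end.

(* The differential from a term in zone s to the next one, in zone t. The last
   case never occurs. *)
Definition zone_diff (a : int) (s t : zone) : ambient s -> ambient t :=
  match s return ambient s -> ambient t with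
  | low => match t return ambient low -> ambient t with
           | low => Kos_Phi | _ => fun _ => 0 end
  | mid => match t return ambient mid -> ambient t with
           | low => d_mid_low a | _ => fun _ => 0 end
  | high => match t return ambient high -> ambient t with
            | mid => d_high_mid | high => eta_Phi | low => fun _ => 0 end
  end.

(* d_j, for k = j - 1; keeping k as a parameter avoids transporting along
   j + 1 - 1 = j. *)
Definition hook_diff (i a j k : int) :
    ambient (zone_of i j) -> ambient (zone_of i k) :=
  zone_diff a (zone_of i k).

(* H_j = 0: every cycle is a boundary. *)
Definition homology_vanishes (i a j : int) : Prop :=
  forall x, hook_term a x -> hook_diff a (j - 1) x = 0 ->
  exists2 y : ambient (zone_of i (j + 1)), hook_term a y & hook_diff a j y = x.

End HookComplex.

(* A [vectType R] is a free R-module of finite rank [dim V] together with a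
   choice of basis, through the coordinate isomorphism [v2r]. *)
Section Coordinates.
Import VectorInternalTheory.
Variable R : comNzRingType.

Definition std_basis (V : vectType R) (k : 'I_(dim V)) : V :=
  r2v (delta_mx 0 k).

Definition coordinate (V : vectType R) (k : 'I_(dim V)) (v : V) : R^o :=
  v2r v 0 k.

Definition dual_basis (V : vectType R) (k : 'I_(dim V)) : 'Hom(V, R^o) :=
  linfun (coordinate k).

Fact coordinate_is_linear (V : vectType R) (k : 'I_(dim V)) :
  linear (coordinate k).
Proof. by move=> c u v; rewrite /coordinate linearP !mxE. Qed.

HB.instance Definition _ (V : vectType R) (k : 'I_(dim V)) :=
  GRing.isLinear.Build R V R^o *:%R (coordinate k) (coordinate_is_linear k).

Fact dual_basisE (V : vectType R) (k l : 'I_(dim V)) :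
  dual_basis l (std_basis k) = (k == l)%:R.
Proof. by rewrite lfunE /= /coordinate r2vK mxE eqxx eq_sym. Qed.

Fact std_basis_sum (V : vectType R) (v : V) :
  v = \sum_k dual_basis k v *: std_basis k.
Proof.
apply: v2r_inj; rewrite linear_sum /= [LHS]row_sum_delta.
by apply: eq_bigr => k _; rewrite linearZ /= r2vK lfunE.
Qed.

Definition matrix_of (F G : vectType R) (Phi : 'Hom('Hom(G, R^o), F)) :
    'M[R]_(dim F, dim G) :=
  \matrix_(k, l) coordinate k (Phi (dual_basis l)).

End Coordinates.

(* Main.v *)
Require Import Defs.
From HB Require Import structures.
From mathcomp Require Import all_boot all_order all_algebra.
From mathcomp Require Import mpoly zify ring.

(* For a maximal minor x of A there are square matrices P and Q with Q E = A,
   P A = x E and Q P = x, where E is the 0/1 matrix of the inclusion of a set of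
   coordinates. Since the exterior algebra is functorial, P maps a cycle of the
   complex of A to a cycle of the complex of E up to a power of x, and Q maps
   boundaries back. As the complex of E is exact, a power of x kills the homology
   of the complex of A.

   Exactness for E holds over every ring: Kos, kappa, eta and eta_Phi are sums of
   one-variable differentials, each with a contraction free of denominators, and
   the hook modules are reached by a double complex chase (induction on the
   exterior degree).

   The hook modules are direct summands of free modules, so a regular sequence
   x_1, .., x_n of R is weakly regular on every term. Nilpotency of the x_k on the
   homology passes to the complex modulo x_1, .., x_k. If the homology modulo
   x_1, .., x_k+1 vanishes in position j + 1, then x_k+1 is injective on the
   homology modulo x_1, .., x_k in position j; being nilpotent, it forces that
   homology to vanish. Starting from the positions beyond the length of the complex,
   descending induction on k gains one position for each x_k. *)

Set Implicit Arguments.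
Unset Strict Implicit.
Unset Printing Implicit Defensive.

Import Order.TTheory GRing.Theory Num.Theory.
Local Open Scope ring_scope.

(** For E, [Kos_Phi] and [eta_Phi] can fail to be exact only in polynomial degree 0, and [kappa] and
    [eta] only in bidegree (0, 0); these failures account for the middle term. The low zone meets
    them in Sym degree 1: a preimage under [Kos_Phi] then has degree 0 and is forced to have the
    form $\sum_T x\wedge\Phi_T\otimes n_T$, which is where $d_{i+1}$ comes from. The high zone meets
    them in $D_0$, where every element is a cycle of [eta_Phi] and the condition coming from
    $d_{i+2}$ takes over. At the middle term all maps are monomial and exactness is a count of
    subsets. Multiples of the regular sequence are taken inside each term, whereas regularity is
    known on free modules. The linear contractions of [kappa] and [eta] supply the projections that
    reconcile the two. The bound $i\le\mathfrak f-\mathfrak g$ places every position beyond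
    $\mathfrak f-\mathfrak g+1$ in the high zone with negative exterior degree, where the descending
    induction starts. *)

Section ExtMap.
Variables (R : comNzRingType) (n : nat).

Lemma ext_map_is_linear (M N : lmodType R) (h : {linear M -> N}) :
  linear (@ext_map R n M N h).
Proof. by move=> c x y; apply/ffunP=> S; rewrite !ffunE linearP. Qed.

HB.instance Definition _ (M N : lmodType R) (h : {linear M -> N}) :=
  GRing.isLinear.Build R (ext n M) (ext n N) _ (@ext_map R n M N h)
    (ext_map_is_linear h).

End ExtMap.

(** * Exterior multiplication and contraction *)

Section Clifford.
Variables (R : comNzRingType) (n : nat) (M : lmodType R).
Implicit Types (b : bool) (k l : 'I_n) (S T : {set 'I_n}) (x y : ext n M).

Definition bef b k l := if b then (k < l)%N else (l < k)%N.

Definition ext_sign b k S : R := (-1) ^+ #|[set t in S | bef b k t]|.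

(* [b = true] gives right multiplication and right contraction by the k-th basis
   vector, [b = false] the left ones. *)
Definition cre b k x : ext n M :=
  [ffun S : {set 'I_n} => if k \in S then ext_sign b k S *: x (S :\ k) else 0].

Definition ann b k x : ext n M :=
  [ffun S : {set 'I_n} => if k \in S then 0 else ext_sign b k S *: x (k |: S)].

Lemma cre_is_linear b k : linear (cre b k).
Proof.
move=> c x y; apply/ffunP=> S; rewrite !ffunE; case: ifP => _.
  by rewrite scalerDr !scalerA mulrC.
by rewrite scaler0 addr0.
Qed.

HB.instance Definition _ b k :=
  GRing.isLinear.Build R (ext n M) (ext n M) _ (cre b k) (cre_is_linear b k).

Lemma ann_is_linear b k : linear (ann b k).
Proof.
move=> c x y; apply/ffunP=> S; rewrite !ffunE; case: ifP => _.
  by rewrite scaler0 addr0.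
by rewrite scalerDr !scalerA mulrC.
Qed.

HB.instance Definition _ b k :=
  GRing.isLinear.Build R (ext n M) (ext n M) _ (ann b k) (ann_is_linear b k).

Lemma befkk b k : bef b k k = false.
Proof. by case: b; rewrite /bef ltnn. Qed.

Lemma bef_neg b k l : k != l -> bef b l k = ~~ bef b k l.
Proof. by rewrite -val_eqE /= => kl; case: b; rewrite /bef -leqNgt ltn_neqAle ?kl // eq_sym kl. Qed.

Lemma ext_signsq b k S : ext_sign b k S * ext_sign b k S = 1.
Proof. by rewrite -expr2 sqrr_sign. Qed.

Lemma ext_signD1 b k l S :
  ext_sign b l (S :\ k) = (-1) ^+ ((k \in S) && bef b l k) * ext_sign b l S.
Proof.
rewrite /ext_sign.
have -> : [set t in S :\ k | bef b l t] = [set t in S | bef b l t] :\ k.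
  by apply/setP=> t; rewrite !inE andbA.
rewrite [in RHS](cardsD1 k [set t in S | bef b l t]) inE exprD mulrA -expr2.
by rewrite sqrr_sign mul1r.
Qed.

Lemma ext_signU1 b k l S :
  ext_sign b l (k |: S) = (-1) ^+ ((k \notin S) && bef b l k) * ext_sign b l S.
Proof.
case: (boolP (k \in S)) => kS; first by rewrite (setUidPr _) ?sub1set // mul1r.
have := ext_signD1 b k l (k |: S); rewrite setU1K // setU11 /= => ->.
by rewrite mulrA -expr2 sqrr_sign mul1r.
Qed.

Lemma ext_signD1id b k S : ext_sign b k (S :\ k) = ext_sign b k S.
Proof. by rewrite ext_signD1 befkk andbF mul1r. Qed.

Lemma ext_signU1id b k S : ext_sign b k (k |: S) = ext_sign b k S.
Proof. by rewrite ext_signU1 befkk andbF mul1r. Qed.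

Lemma cre_cre b k x : cre b k (cre b k x) = 0.
Proof.
by apply/ffunP=> S; rewrite !ffunE; case: ifP => // kS; rewrite setD11 scaler0.
Qed.

Lemma ann_ann b k x : ann b k (ann b k x) = 0.
Proof.
by apply/ffunP=> S; rewrite !ffunE; case: ifP => // kS; rewrite setU11 scaler0.
Qed.

Lemma cre_anti b k l x : k != l -> cre b k (cre b l x) = - cre b l (cre b k x).
Proof.
move=> kl; apply/ffunP=> S; rewrite !ffunE !in_setD1 (eq_sym l) kl /=.
case kS: (k \in S); case lS: (l \in S); rewrite ?scaler0 ?oppr0 //.
rewrite !scalerA !ext_signD1 kS lS /= !(bef_neg b kl) setDDl setUC -setDDl.
rewrite -scaleNr; congr (_ *: _); case: (bef b k l); rewrite /=; ring.
Qed.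

Lemma ann_anti b k l x : k != l -> ann b k (ann b l x) = - ann b l (ann b k x).
Proof.
move=> kl; apply/ffunP=> S; rewrite !ffunE !in_setU1 (eq_sym l) (negbTE kl) /=.
case kS: (k \in S); case lS: (l \in S); rewrite ?scaler0 ?oppr0 //.
rewrite !scalerA !ext_signU1 kS lS /= !(bef_neg b kl) setUCA.
rewrite -scaleNr; congr (_ *: _); case: (bef b k l); rewrite /=; ring.
Qed.

Lemma ann_cre_anti b k l x : k != l -> ann b k (cre b l x) = - cre b l (ann b k x).
Proof.
move=> kl; apply/ffunP=> S.
rewrite !ffunE !in_setU1 !in_setD1 (eq_sym l k) (negbTE kl) /=.
case kS: (k \in S); case lS: (l \in S); rewrite ?scaler0 ?oppr0 //.
rewrite !scalerA ext_signU1 ext_signD1 kS lS /= (bef_neg b kl).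
have -> : (k |: S) :\ l = k |: S :\ l.
  apply/setP=> t; rewrite !inE; case: (t =P k) => [->|]; by rewrite ?kl.
rewrite -scaleNr; congr (_ *: _); case: (bef b k l); rewrite /=; ring.
Qed.

Lemma cre_ann_anti b k l x : k != l -> cre b k (ann b l x) = - ann b l (cre b k x).
Proof. by move=> kl; rewrite ann_cre_anti ?opprK // eq_sym. Qed.

Lemma cre_annD b k x : cre b k (ann b k x) + ann b k (cre b k x) = x.
Proof.
apply/ffunP=> S; rewrite !ffunE !inE !eqxx /=; case: ifP => kS.
  by rewrite addr0 scalerA ext_signD1id ext_signsq scale1r setD1K.
by rewrite add0r scalerA ext_signU1id ext_signsq scale1r setU1K ?kS.
Qed.

Lemma contractE k x : contract k x = ann false k x.
Proof. by []. Qed.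

(** In the decomposition [cre_annD] the summand [ann b k (cre b k x)] vanishes at every set
    containing k, and the other one vanishes by hypothesis. *)
Lemma ann_eq0 b x (S : {set 'I_n}) : (forall k, ann b k x = 0) -> S != set0 -> x S = 0.
Proof.
move=> x0 /set0Pn[k kS]; rewrite -(cre_annD b k x) x0 linear0 add0r.
by rewrite ffunE kS.
Qed.

End Clifford.

(** * Signs, bilinearity and associativity of the wedge product *)

Lemma inversionsE n (A B : {set 'I_n}) :
  inversions A B = (\sum_(a in A) \sum_(b in B) (b < a)%N)%N.
Proof.
rewrite pair_big_dep -big_mkcondr /= sum1dep_card; apply: eq_card => -[a b].
by rewrite !inE.
Qed.

Lemma inversionsUl n (A B C : {set 'I_n}) :
  [disjoint A & B] -> inversions (A :|: B) C = (inversions A C + inversions B C)%N.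
Proof.
move=> dAB; rewrite !inversionsE (eq_bigl [predU A & B]) ?bigU //=.
by move=> a; rewrite !inE.
Qed.

Lemma inversionsUr n (A B C : {set 'I_n}) :
  [disjoint B & C] -> inversions A (B :|: C) = (inversions A B + inversions A C)%N.
Proof.
move=> dBC; rewrite !inversionsE -big_split; apply: eq_bigr => a _ /=.
by rewrite (eq_bigl [predU B & C]) ?bigU //= => b; rewrite !inE.
Qed.

Lemma inversions0l n (A : {set 'I_n}) : inversions set0 A = 0%N.
Proof. by rewrite inversionsE big_set0. Qed.

Lemma inversions0r n (A : {set 'I_n}) : inversions A set0 = 0%N.
Proof. by rewrite inversionsE big1 // => a _; rewrite big_set0. Qed.

(** The reindexing behind the sign comparisons below: sums over sets from which k is removed become
    sums over sets to which k is added. *)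
Lemma sum_set_in (R : nmodType) n (k : 'I_n) (F : {set 'I_n} -> R) :
  \sum_(S : {set 'I_n} | k \in S) F S = \sum_(S : {set 'I_n} | k \notin S) F (k |: S).
Proof.
rewrite (reindex_onto (fun S => k |: S) (fun S => S :\ k)) /=; last first.
  by move=> S kS; rewrite setD1K.
apply: eq_bigl => S; rewrite setU11 /=; apply/eqP/idP => [<-|kS].
  by rewrite setD11.
by rewrite setU1K.
Qed.

Section WedgeLinear.
Variables (R : comNzRingType) (n : nat) (M : lmodType R).
Implicit Types (x y : ext n M) (u v w : ext n R^o) (m : M).

Definition rwedge w x := wedge x w.
Definition lwedge x w := wedge x w.

Lemma rwedge_is_linear w : linear (rwedge w).
Proof.
move=> c x y; apply/ffunP=> S; rewrite !ffunE scaler_sumr -big_split.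
by apply: eq_bigr => A _; rewrite !ffunE scalerDr !scalerA mulrC.
Qed.

HB.instance Definition _ w :=
  GRing.isLinear.Build R (ext n M) (ext n M) _ (rwedge w) (rwedge_is_linear w).

Lemma lwedge_is_linear x : linear (lwedge x).
Proof.
move=> c u v; apply/ffunP=> S; rewrite !ffunE scaler_sumr -big_split.
apply: eq_bigr => A _ /=; rewrite !ffunE scalerA -scalerDl; congr (_ *: _).
by rewrite mulrDr mulrCA.
Qed.

HB.instance Definition _ x :=
  GRing.isLinear.Build R (ext n R^o) (ext n M) _ (lwedge x) (lwedge_is_linear x).

Lemma wedge_suml I (r : seq I) (P : pred I) (F : I -> ext n M) w :
  wedge (\sum_(i <- r | P i) F i) w = \sum_(i <- r | P i) wedge (F i) w.
Proof. exact: (linear_sum (rwedge w)). Qed.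

Lemma wedge_sumr I (r : seq I) (P : pred I) (F : I -> ext n R^o) x :
  wedge x (\sum_(i <- r | P i) F i) = \sum_(i <- r | P i) wedge x (F i).
Proof. exact: (linear_sum (lwedge x)). Qed.

Lemma wedgeZl c x w : wedge (c *: x) w = c *: wedge x w.
Proof. exact: (linearZ_LR (rwedge w)). Qed.

Lemma wedgeZr c x w : wedge x (c *: w) = c *: wedge x w.
Proof. exact: (linearZ_LR (lwedge x)). Qed.

Lemma wedge0l w : wedge (0 : ext n M) w = 0.
Proof. exact: (linear0 (rwedge w)). Qed.

Lemma wedge0r x : wedge x 0 = 0.
Proof. exact: (linear0 (lwedge x)). Qed.

Lemma wedgeNl x w : wedge (- x) w = - wedge x w.
Proof. exact: (linearN (rwedge w)). Qed.

Lemma wedgeDl x y w : wedge (x + y) w = wedge x w + wedge y w.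
Proof. exact: (linearD (rwedge w)). Qed.

Lemma tensZl c u m : tens (c *: u) m = c *: tens u m.
Proof. by apply/ffunP=> S; rewrite !ffunE scalerA. Qed.

Lemma tensZr c u m : tens u (c *: m) = c *: tens u m.
Proof. by apply/ffunP=> S; rewrite !ffunE !scalerA mulrC. Qed.

Lemma tens0r u : tens u (0 : M) = 0.
Proof. by apply/ffunP=> S; rewrite !ffunE scaler0. Qed.

Lemma tens0l m : tens (0 : ext n R^o) m = 0.
Proof. by apply/ffunP=> S; rewrite !ffunE scale0r. Qed.

Lemma tensDr u m1 m2 : tens u (m1 + m2) = tens u m1 + tens u m2 :> ext n M.
Proof. by apply/ffunP=> S; rewrite !ffunE scalerDr. Qed.

Lemma tens_suml I (r : seq I) (P : pred I) (F : I -> ext n R^o) m :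
  tens (\sum_(i <- r | P i) F i) m = \sum_(i <- r | P i) tens (F i) m.
Proof.
apply/ffunP=> S; rewrite ffunE !sum_ffunE scaler_suml.
by apply: eq_bigr => i _; rewrite ffunE.
Qed.

Lemma wedge_tens u v m : wedge (tens u m) v = tens (wedge u v) m.
Proof.
apply/ffunP=> S; rewrite !ffunE scaler_suml; apply: eq_bigr => A _.
by rewrite !ffunE scalerA.
Qed.

Lemma ext_tens_sum x : x = \sum_S tens (ext_basis R S) (x S).
Proof.
apply/ffunP=> T; rewrite sum_ffunE (bigD1 T) //= !ffunE eqxx scale1r big1 ?addr0 //.
by move=> S nST; rewrite !ffunE eq_sym (negbTE nST) scale0r.
Qed.

End WedgeLinear.

Section WedgeAssoc.
Variables (R : comNzRingType) (n : nat).
Implicit Types (u v w : ext n R^o) (A B C S : {set 'I_n}).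

Lemma tens1 u : tens u (1 : R^o) = u.
Proof. by apply/ffunP=> S; rewrite !ffunE; exact: mulr1. Qed.

Lemma ext_basis_sum u : u = \sum_S u S *: ext_basis R S.
Proof.
rewrite [LHS]ext_tens_sum; apply: eq_bigr => S _.
by apply/ffunP=> T; rewrite !ffunE; exact: mulrC.
Qed.

Lemma wedge_basis A B :
  wedge (ext_basis R A) (ext_basis R B) =
  if [disjoint A & B] then (-1) ^+ inversions A B *: ext_basis R (A :|: B) else 0.
Proof.
apply/ffunP=> S; rewrite ffunE; have [sAS|nAS] := boolP (A \subset S); last first.
  rewrite big1 => [|C]; last first.
    rewrite inE !ffunE => sCS; case: (C =P A) => [CA|_]; last by rewrite mulr0n scaler0.
    by rewrite -CA sCS in nAS.
  case: ifP => _; rewrite !ffunE //; case: eqP => [SE|_]; last by rewrite mulr0n; symmetry; apply: scaler0.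
  by rewrite SE subsetUl in nAS.
rewrite (bigD1 A) ?inE //= big1 => [|C]; last first.
  by rewrite inE !ffunE => /andP[_ /negbTE->]; rewrite mulr0n scaler0.
rewrite addr0 !ffunE eqxx.
have -> : (S :\: A == B) = [disjoint A & B] && (S == A :|: B).
  apply/eqP/andP => [<-|[dAB /eqP->]].
    split; first by rewrite -setI_eq0; apply/eqP/setP=> t; rewrite !inE; case: (t \in A).
    apply/eqP/setP=> t; rewrite !inE; case: (boolP (t \in A)) => // tA.
    by rewrite (subsetP sAS).
  by rewrite setDUl setDv set0U; apply/setDidPl; rewrite disjoint_sym.
have [dAB|] /= := ifPn; last by move=> _; rewrite mulr0 scale0r ffunE.
rewrite !ffunE; case: eqP => [->|_]; last by rewrite mulr0 scale0r scaler0.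
by rewrite mulr1n mulr1 setDUl setDv set0U (setDidPl _) // disjoint_sym.
Qed.

Lemma wedge1r (M : lmodType R) (x : ext n M) : wedge x (ext_basis R set0) = x.
Proof.
apply/ffunP=> S; rewrite ffunE (bigD1 S) ?inE //= big1 => [|A].
  by rewrite setDv inversions0r ffunE eqxx mulr1 scale1r addr0.
rewrite inE !ffunE => /andP[sAS nAS]; case: eqP => [/eqP|]; last by rewrite mulr0 scale0r.
by rewrite setD_eq0 => sSA; rewrite eqEsubset sAS sSA in nAS.
Qed.

Lemma wedge1l u : wedge (ext_basis R set0) u = u.
Proof.
rewrite [u]ext_basis_sum wedge_sumr; apply: eq_bigr => S _.
by rewrite wedgeZr wedge_basis disjoints_subset sub0set inversions0l set0U scale1r.
Qed.

(** The signs agree because [inversions] is additive in each argument over disjoint unions. *)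
Lemma wedge_basisA A B C :
  wedge (wedge (ext_basis R A) (ext_basis R B)) (ext_basis R C) =
  wedge (ext_basis R A) (wedge (ext_basis R B) (ext_basis R C)).
Proof.
rewrite (wedge_basis A B) (wedge_basis B C).
have disjU (D1 D2 D3 : {set 'I_n}) :
    [disjoint D1 :|: D2 & D3] = [disjoint D1 & D3] && [disjoint D2 & D3].
  by rewrite -!setI_eq0 setIUl setU_eq0.
have disjUr (D1 D2 D3 : {set 'I_n}) :
    [disjoint D1 & D2 :|: D3] = [disjoint D1 & D2] && [disjoint D1 & D3].
  by rewrite ![[disjoint D1 & _]]disjoint_sym disjU.
case: ifP => dAB; case: ifP => dBC; rewrite ?wedge0l ?wedge0r ?wedgeZl ?wedgeZr //.
- rewrite !wedge_basis disjU disjUr dAB dBC andbT /=; case: ifP => dAC; last by rewrite !scaler0.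
  rewrite !scalerA setUA inversionsUl // inversionsUr // !exprD; congr (_ *: _); ring.
- by rewrite wedge_basis disjU dBC andbF /= scaler0.
- by rewrite wedge_basis disjUr dAB /= scaler0.
Qed.

(** Both sides are linear in each argument, so the arguments are replaced by basis vectors one at a
    time. *)
Lemma wedgeA (M : lmodType R) (x : ext n M) v w :
  wedge (wedge x v) w = wedge x (wedge v w).
Proof.
have basisAr A B : wedge (wedge (ext_basis R A) (ext_basis R B)) w =
    wedge (ext_basis R A) (wedge (ext_basis R B) w).
  rewrite [w]ext_basis_sum !wedge_sumr; apply: eq_bigr => C _.
  by rewrite !wedgeZr wedge_basisA.
have basisA A : wedge (wedge (ext_basis R A) v) w = wedge (ext_basis R A) (wedge v w).
  rewrite [v]ext_basis_sum !(wedge_sumr, wedge_suml); apply: eq_bigr => B _.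
  by rewrite !(wedgeZr, wedgeZl) basisAr.
rewrite [x]ext_tens_sum !wedge_suml; apply: eq_bigr => A _.
by rewrite !wedge_tens basisA.
Qed.

Lemma wedge_vect (M : lmodType R) (x : ext n M) k :
  wedge x (ext_basis R [set k]) = cre true k x.
Proof.
apply/ffunP=> S; rewrite !ffunE; case: ifP => kS; last first.
  apply: big1 => A; rewrite inE !ffunE => sAS; case: eqP => [E|]; last by rewrite mulr0 scale0r.
  by have: k \in S :\: A; [rewrite E set11 | rewrite inE kS andbF].
rewrite (bigD1 (S :\ k)) ?inE ?subD1set //= big1 => [|A].
  have -> : S :\: (S :\ k) = [set k].
    apply/setP=> t; rewrite !inE negb_and negbK.
    by case: eqP => [->|] /=; rewrite ?kS ?andNb.
  rewrite ffunE eqxx mulr1 addr0 -ext_signD1id; congr ((-1) ^+ _ *: _).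
  rewrite inversionsE -sum1_card [RHS]big_mkcond [LHS]big_mkcond /=.
  apply: eq_bigr => t _; rewrite big_set1 [in RHS]inE /bef.
  by case: (t \in _) => //=; case: ltnP.
rewrite inE !ffunE => /andP[sAS nA]; case: eqP => [E|]; last by rewrite mulr0 scale0r.
case/eqP: nA; apply/setP=> t; move/setP/(_ t): E; rewrite !inE => <-.
case: (boolP (t \in A)) => [tA|_] /=; last by case: (t \in S).
by rewrite (subsetP sAS).
Qed.

End WedgeAssoc.

(** The terms (k, l) and (l, k) cancel. The diagonal needs its own hypothesis, since 2 may be a zero
    divisor and antisymmetry then says too little about [F k k]. *)
Lemma sum_anti_eq0 (V : zmodType) g (F : 'I_g -> 'I_g -> V) :
  (forall k, F k k = 0) -> (forall k l, k != l -> F k l = - F l k) ->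
  \sum_k \sum_l F k l = 0.
Proof.
move=> F0 FN; rewrite pair_big /=.
rewrite (bigID (fun p : 'I_g * 'I_g => (p.1 < p.2)%N)) /=.
rewrite [X in _ + X](bigID (fun p : 'I_g * 'I_g => p.1 == p.2)) /=.
rewrite [X in _ + (X + _)]big1 ?add0r => [|[k l] /= /andP[_ /eqP->] //].
rewrite [X in _ + X](reindex_inj (h := fun p => (p.2, p.1))) /=; last by move=> [? ?] [? ?] [-> ->].
rewrite [X in _ + X](eq_bigl (fun p : 'I_g * 'I_g => (p.1 < p.2)%N)) => [|[k l] /=].
  rewrite -big_split big1 //= => -[k l] /= kl; rewrite [F l k]FN ?subrr //.
  by rewrite -val_eqE /= gtn_eqF.
by rewrite -leqNgt -val_eqE /= ltn_neqAle andbC eq_sym.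
Qed.

Section Vectors.
Variables (R : comNzRingType) (n : nat).
Implicit Types (c d : 'I_n -> R).

(** Makes the iterated wedge product in [ext_Phi] accessible to [big_cat]. *)
HB.instance Definition _ := Monoid.isLaw.Build (ext n R^o) (ext_basis R set0)
  (@wedge R n R^o) (fun u v w => esym (wedgeA u v w)) (@wedge1l R n)
  (@wedge1r R n R^o).

Lemma wedge_ext_vect (M : lmodType R) (x : ext n M) c :
  wedge x (ext_vect c) = \sum_k c k *: cre true k x.
Proof.
by rewrite wedge_sumr; apply: eq_bigr => k _; rewrite wedgeZr wedge_vect.
Qed.

Lemma wedge_vect_anti (M : lmodType R) (x : ext n M) c d :
  wedge (wedge x (ext_vect c)) (ext_vect d) =
  - wedge (wedge x (ext_vect d)) (ext_vect c).
Proof.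
rewrite !wedge_ext_vect -sumrN.
under eq_bigr => k _ do rewrite linear_sum scaler_sumr /=.
under [RHS]eq_bigr => k _ do rewrite linear_sum scaler_sumr -sumrN /=.
rewrite exchange_big; apply: eq_bigr => k _; apply: eq_bigr => l _ /=.
rewrite ![cre _ _ (_ *: _)]linearZ_LR /= !scalerA mulrC; case: (l =P k) => [->|/eqP lk].
  by rewrite cre_cre !scaler0 oppr0.
by rewrite cre_anti // scalerN.
Qed.

Lemma wedge_vect_sq (M : lmodType R) (x : ext n M) c :
  wedge (wedge x (ext_vect c)) (ext_vect c) = 0.
Proof.
rewrite !wedge_ext_vect.
under eq_bigr => k _ do rewrite linear_sum scaler_sumr /=.
apply: sum_anti_eq0 => [k|k l kl]; rewrite ![cre _ _ (_ *: _)]linearZ_LR /= ?cre_cre ?scaler0 //.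
by rewrite cre_anti // !scalerN !scalerA mulrC.
Qed.

Lemma wedge_vectC c d :
  wedge (ext_vect c) (ext_vect d) = - wedge (ext_vect d) (ext_vect c).
Proof.
have := wedge_vect_anti (ext_basis R set0) c d.
by rewrite !wedge1l.
Qed.

End Vectors.

(** * Products of columns of a matrix *)

Section ExtPhi.
Variables (R : comNzRingType) (f g : nat) (A : 'M[R]_(f, g)).
Implicit Types (s : seq 'I_g) (T : {set 'I_g}).

Definition wprod s := \big[@wedge R f R^o/ext_basis R set0]_(l <- s) Phi_basis A l.

Lemma wprod_cons k s : wprod (k :: s) = wedge (Phi_basis A k) (wprod s).
Proof. by rewrite /wprod big_cons. Qed.

Lemma wprod_cat s1 s2 : wprod (s1 ++ s2) = wedge (wprod s1) (wprod s2).
Proof. by rewrite /wprod big_cat. Qed.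

Lemma wedge_vect_wprod c s :
  wedge (ext_vect c) (wprod s) = (-1) ^+ size s *: wedge (wprod s) (ext_vect c).
Proof.
elim: s => [|k s IHs]; first by rewrite /wprod big_nil wedge1r wedge1l scale1r.
rewrite wprod_cons -wedgeA wedge_vectC wedgeNl wedgeA IHs wedgeZr -wedgeA.
by rewrite exprS -scalerA scaleN1r.
Qed.

Lemma sorted_enum_ord (T : {set 'I_g}) : sorted ltn (map val (enum T)).
Proof.
rewrite sorted_map /(enum T) /enum_mem -enumT; apply: sorted_filter; first by move=> i j k; apply: ltn_trans.
by rewrite -sorted_map val_enum_ord iota_ltn_sorted.
Qed.

Lemma eq_enum_sorted s T : sorted ltn (map val s) -> s =i T -> s = enum T.
Proof.
move=> s_sorted sT; apply: (inj_map val_inj).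
apply: (irr_sorted_eq ltn_trans ltnn) => //; first exact: sorted_enum_ord.
by apply: eq_mem_map => t; rewrite sT mem_enum.
Qed.

(** Locates k in the increasing enumeration, so that products over T and over k |: T can be compared
    factor by factor. *)
Lemma enum_split (k : 'I_g) T (s1 := [seq t : 'I_g <- enum T | (t < k)%N])
    (s2 := [seq t : 'I_g <- enum T | (k < t)%N]) :
  enum (k |: T) = s1 ++ k :: s2 /\
  enum T = if k \in T then s1 ++ k :: s2 else s1 ++ s2.
Proof.
have sp r : sorted ltn (map val [seq t : 'I_g <- enum T | r t]).
  rewrite sorted_map sorted_filter -?sorted_map ?sorted_enum_ord //.
  by move=> ? ? ?; apply: ltn_trans.
have s12 : sorted ltn (map val (s1 ++ k :: s2)).
  rewrite (sorted_pairwise ltn_trans) map_cat pairwise_cat /= -!(sorted_pairwise ltn_trans) !sp !andbT.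
  apply/andP; split; last by apply/allP=> _ /mapP[t + ->]; rewrite mem_filter => /andP[].
  apply/allrelP=> _ y /mapP[t + ->]; rewrite mem_filter => /andP[tk _].
  rewrite inE => /orP[/eqP-> //|/mapP[u + ->]]; rewrite mem_filter => /andP[ku _].
  exact: ltn_trans ku.
have s12' : sorted ltn (map val (s1 ++ s2)).
  by apply: subseq_sorted s12; [exact: ltn_trans | apply/map_subseq/cat_subseq => //; exact: subseq_cons].
have memP t : (t \in s1 ++ k :: s2) = (t == k) || (t \in T).
  rewrite mem_cat in_cons !mem_filter -enumT !mem_enum !andbT -val_eqE /=; case: ltngtP => //=.
  by case: (t \in T).
split; first by apply/esym/eq_enum_sorted => // t; rewrite memP !inE.
apply/esym; case: ifP => kT; apply: eq_enum_sorted => // t.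
  by rewrite memP; case: eqP => [->|].
have := memP t; rewrite !mem_cat in_cons; case: eqP => [->|_ -> //] _.
by rewrite !mem_filter ltnn kT.
Qed.

Lemma wedge_wprod_vect c s :
  wedge (wprod s) (ext_vect c) = (-1) ^+ size s *: wedge (ext_vect c) (wprod s).
Proof. by rewrite wedge_vect_wprod scalerA -expr2 sqrr_sign scale1r. Qed.

(** The new factor moves left past the elements of T above k, at the cost of one sign each. If k is
    already in T it reaches its own copy and the square vanishes. *)
Lemma ext_Phi_wedge k T : wedge (ext_Phi A T) (Phi_basis A k) =
  if k \in T then 0 else ext_sign R true k T *: ext_Phi A (k |: T).
Proof.
have [] := enum_split k T; set s1 := filter _ _; set s2 := filter _ _ => EU ET.
rewrite /ext_Phi EU [X in \big[_/_]_(l <- X) _]ET -/(wprod _) -/(wprod _).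
case: ifP => kT.
  rewrite wprod_cat wprod_cons wedgeA [wedge _ (Phi_basis A k)]wedgeA.
  rewrite wedge_wprod_vect wedgeZr -wedgeA.
  by rewrite -[Phi_basis A k]wedge1l wedge_vect_sq wedge0l scaler0 wedge0r.
rewrite !wprod_cat wprod_cons wedgeA wedge_wprod_vect wedgeZr; congr (_ ^+ _ *: _).
rewrite cardE; congr (size _); apply/eq_enum_sorted => [|t].
  rewrite sorted_map sorted_filter -?sorted_map ?sorted_enum_ord //.
  by move=> ? ? ?; apply: ltn_trans.
by rewrite mem_filter mem_enum !inE andbC.
Qed.

End ExtPhi.

(** * Submodules and graded parts *)

Section Submodules.
Variable R : comNzRingType.

Definition submod (M : lmodType R) (N : M -> Prop) : Prop :=
  [/\ N 0, forall x y, N x -> N y -> N (x + y) & forall c x, N x -> N (c *: x)].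

Lemma submod_sum (M : lmodType R) (N : M -> Prop) I (r : seq I) (P : pred I) F :
  submod N -> (forall i, P i -> N (F i)) -> N (\sum_(i <- r | P i) F i).
Proof. by case=> N0 ND _ NF; apply: big_ind. Qed.

Lemma submodT (M : lmodType R) : submod (fun _ : M => True).
Proof. by []. Qed.

Lemma submod_ext_part n (M : lmodType R) p (N : M -> Prop) :
  submod N -> submod (@ext_part R n M p N).
Proof.
case=> N0 ND NZ; split=> [S|x y Nx Ny S|c x Nx S]; rewrite ffunE; first by case: ifP.
  by have := Nx S; have := Ny S; case: ifP => _; [auto | move=> -> ->; rewrite addr0].
by have := Nx S; case: ifP => _; [auto | move->; rewrite scaler0].
Qed.

Lemma ext_part_basis n (S : {set 'I_n}) :
  ext_part #|S|%:Z (fun _ : R^o => True) (ext_basis R S).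
Proof.
by move=> T; case: ifP => // nT; rewrite ffunE; case: (T =P S) nT => [->|//]; rewrite eqxx.
Qed.

Lemma ext_part_wedge n (M : lmodType R) (N : M -> Prop) p q (x : ext n M) w :
  submod N -> ext_part p N x -> ext_part q (fun _ : R^o => True) w ->
  ext_part (p + q) N (wedge x w).
Proof.
move=> Nsub xN wq S; have [N0 _ NZ] := Nsub; rewrite ffunE.
case: ifPn => Spq.
  apply: submod_sum => // A _; apply: (NZ).
  by have := xN A; case: ifP => // _ ->.
apply: big1 => A; rewrite inE => sAS; have := xN A; have := wq (S :\: A).
have := cardsID A S; rewrite (setIidPr sAS) => cS.
case: ifP => [/eqP wE _|_ -> _]; last by rewrite mulr0 scale0r.
case: ifP => [/eqP xE _|_ ->]; last by rewrite scaler0.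
by case/negP: Spq; rewrite -cS -xE -wE PoszD.
Qed.

Lemma ext_part_map n (M M' : lmodType R) (h : {linear M -> M'}) p
    (N : M -> Prop) (N' : M' -> Prop) (x : ext n M) :
  (forall m, N m -> N' (h m)) -> ext_part p N x -> ext_part p N' (ext_map h x).
Proof.
move=> hN xN S; rewrite ffunE; have := xN S; case: ifP => _; first exact: hN.
by move->; rewrite linear0.
Qed.

Lemma ext_part_Phi f g (A : 'M[R]_(f, g)) (T : {set 'I_g}) :
  ext_part #|T|%:Z (fun _ : R^o => True) (ext_Phi A T).
Proof.
rewrite cardE /ext_Phi; elim: (enum T) => [|l s IHs] /=.
  by rewrite big_nil -[0%N](@cards0 'I_f); exact: ext_part_basis.
rewrite big_cons intS; apply: ext_part_wedge => //; apply: submod_sum => [|k _].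
  exact: submod_ext_part.
have [_ _] := submod_ext_part f 1 (submodT R^o); apply.
by have := @ext_part_basis f [set k]; rewrite cards1.
Qed.

End Submodules.

(** * Functoriality of the exterior algebra *)

Section ExtLin.
Variables (R : comNzRingType) (m n : nat) (Q : 'M[R]_(m, n)).

(** The map $\bigwedge Q\otimes M$ induced by the matrix Q. *)
Definition ext_lin (M : lmodType R) (x : ext n M) : ext m M :=
  \sum_S tens (ext_Phi Q S) (x S).

Lemma ext_lin_is_linear M : linear (@ext_lin M).
Proof.
move=> c x y; rewrite /ext_lin scaler_sumr -big_split; apply: eq_bigr => S _ /=.
by rewrite !ffunE tensDr tensZr.
Qed.

HB.instance Definition _ (M : lmodType R) :=
  GRing.isLinear.Build R (ext n M) (ext m M) _ (@ext_lin M) (@ext_lin_is_linear M).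

Lemma ext_lin_basis S : ext_lin (ext_basis R S) = ext_Phi Q S.
Proof.
rewrite /ext_lin (bigD1 S) //= big1 => [|T nTS]; rewrite ffunE.
  by rewrite eqxx addr0 tens1.
by rewrite (negbTE nTS) tens0r.
Qed.

Lemma ext_lin_tens (M : lmodType R) u (v : M) : ext_lin (tens u v) = tens (ext_lin u) v.
Proof.
rewrite /ext_lin tens_suml; apply: eq_bigr => S _.
by apply/ffunP=> T; rewrite !ffunE scalerA.
Qed.

Lemma ext_lin_map (M N : lmodType R) (h : {linear M -> N}) x :
  ext_lin (ext_map h x) = ext_map h (ext_lin x).
Proof.
rewrite /ext_lin linear_sum; apply: eq_bigr => S _ /=.
by apply/ffunP=> T; rewrite !ffunE linearZ.
Qed.

Lemma ext_lin_part (M : lmodType R) p (N : M -> Prop) x :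
  submod N -> ext_part p N x -> ext_part p N (ext_lin x).
Proof.
move=> Nsub xN; apply: submod_sum; first exact: submod_ext_part.
move=> S _; have := xN S; case: ifP => [/eqP <- Nx|_ ->]; last first.
  by rewrite tens0r; case: (submod_ext_part m p Nsub).
move=> T; rewrite ffunE; have := ext_part_Phi Q S T; case: ifP => [_ _|_ ->].
  by case: Nsub => _ _; apply.
by rewrite scale0r.
Qed.

(** On the right the sets containing k drop out through a repeated factor, on the left the sets
    missing k do; S and k |: S match what remains, with the same sign. *)
Lemma ext_lin_vect (M : lmodType R) (x : ext n M) k :
  ext_lin (wedge x (ext_basis R [set k])) = wedge (ext_lin x) (Phi_basis Q k).
Proof.
rewrite /ext_lin wedge_suml [RHS](bigID (fun S : {set 'I_n} => k \in S)) /=.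
rewrite [X in _ = X + _]big1 ?add0r => [|S kS]; last first.
  by rewrite wedge_tens ext_Phi_wedge kS tens0l.
rewrite wedge_vect (bigID (fun S : {set 'I_n} => k \in S)) /=.
rewrite [X in _ + X = _]big1 ?addr0 => [|S kS]; last first.
  by rewrite ffunE (negbTE kS) tens0r.
rewrite sum_set_in; apply: eq_bigr => S kS.
rewrite wedge_tens ext_Phi_wedge (negbTE kS) tensZl ffunE setU11 tensZr setU1K //.
by rewrite ext_signU1id.
Qed.

Lemma ext_lin_wedge (M : lmodType R) (x : ext n M) g (A : 'M_(n, g)) l :
  ext_lin (wedge x (Phi_basis A l)) = wedge (ext_lin x) (Phi_basis (Q *m A) l).
Proof.
rewrite {1}/Phi_basis wedge_sumr linear_sum /=.
under eq_bigr => k _ do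
  rewrite wedgeZr [ext_lin (_ *: _)]linearZ_LR /= ext_lin_vect -wedgeZr.
rewrite -wedge_sumr; congr wedge; rewrite /Phi_basis /ext_vect.
under eq_bigr => k _ do rewrite scaler_sumr.
rewrite exchange_big; apply: eq_bigr => k _ /=; rewrite mxE scaler_suml.
by apply: eq_bigr => j _; rewrite scalerA mulrC.
Qed.

Lemma ext_lin_wedge_Phi (M : lmodType R) (x : ext n M) g (A : 'M_(n, g)) T :
  ext_lin (wedge x (ext_Phi A T)) = wedge (ext_lin x) (ext_Phi (Q *m A) T).
Proof.
rewrite /ext_Phi; elim: (enum T) x => [|l s IHs] x.
  by rewrite !big_nil !wedge1r.
by rewrite !big_cons -!wedgeA IHs ext_lin_wedge.
Qed.

End ExtLin.

Section ExtLinComp.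
Variable R : comNzRingType.

Lemma ext_Phi0 f g (A : 'M[R]_(f, g)) : ext_Phi A set0 = ext_basis R set0.
Proof. by rewrite /ext_Phi enum_set0 big_nil. Qed.

Lemma ext_lin_comp m n p (Q : 'M[R]_(m, n)) (P : 'M[R]_(n, p)) (M : lmodType R)
    (x : ext p M) : ext_lin Q (ext_lin P x) = ext_lin (Q *m P) x.
Proof.
rewrite {2 3}/ext_lin linear_sum; apply: eq_bigr => S _ /=.
(* Writing [ext_Phi P S] as a product with 1 reduces functoriality to multiplicativity. *)
rewrite ext_lin_tens -[ext_Phi P S]wedge1l ext_lin_wedge_Phi ext_lin_basis.
by rewrite ext_Phi0 wedge1l.
Qed.

Lemma ext_PhiZ f g (A : 'M[R]_(f, g)) c T :
  ext_Phi (c *: A) T = c ^+ #|T| *: ext_Phi A T.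
Proof.
rewrite cardE /ext_Phi; elim: (enum T) => [|l s IHs] /=.
  by rewrite !big_nil scale1r.
rewrite !big_cons IHs wedgeZr exprSr -scalerA; congr (_ *: _).
rewrite -wedgeZl; congr wedge.
rewrite /Phi_basis /ext_vect scaler_sumr; apply: eq_bigr => k _.
by rewrite mxE scalerA.
Qed.

Definition incl_mx f g (p : 'I_g -> 'I_f) : 'M[R]_(f, g) :=
  \matrix_(k, l) (k == p l)%:R.

Lemma Phi_basis_incl f g (p : 'I_g -> 'I_f) l :
  Phi_basis (incl_mx p) l = ext_basis R [set p l].
Proof.
rewrite /Phi_basis /ext_vect (bigD1 (p l)) //= big1 => [|k /negbTE kp].
  by rewrite mxE eqxx scale1r addr0.
by rewrite mxE kp scale0r.
Qed.

(** An increasing p keeps the factors in order, so no sign appears. *)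
Lemma ext_Phi_incl f g (p : 'I_g -> 'I_f) (T : {set 'I_g}) :
  {homo p : u v / (u < v)%N} -> ext_Phi (incl_mx p) T = ext_basis R (p @: T).
Proof.
move=> p_homo; rewrite /ext_Phi.
have -> : p @: T = p @: [set t in enum T].
  by have -> : [set t in enum T] = T by apply/setP=> t; rewrite inE mem_enum.
elim: (enum T) (sorted_enum_ord T) => [|l s IHs] /= s_sorted.
  rewrite big_nil; congr ext_basis; apply/esym/eqP; rewrite -subset0.
  by apply/subsetP=> _ /imsetP[t + ->]; rewrite inE.
rewrite big_cons {}IHs ?(path_sorted s_sorted) // Phi_basis_incl wedge_basis.
have ls t : t \in s -> (p l < p t)%N.
  move=> ts; apply/p_homo; have := order_path_min ltn_trans s_sorted.
  by move/allP; apply; apply: map_f.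
have -> : p @: [set t in l :: s] = [set p l] :|: p @: [set t in s].
  by rewrite set_cons imsetU1.
case: ifP => [_|/negbT/negP[]]; last first.
  rewrite disjoints_subset sub1set inE; apply/negP=> /imsetP[t].
  by rewrite inE => /ls; move=> lt e; rewrite e ltnn in lt.
rewrite inversionsE big_set1 big1 ?scale1r // => _ /imsetP[t + ->].
by rewrite inE => /ls; case: ltngtP.
Qed.

Lemma ext_lin_scalar n c (M : lmodType R) p (N : M -> Prop) (x : ext n M) :
  ext_part p N x -> exists k, ext_lin c%:M x = c ^+ k *: x.
Proof.
(* For negative p every coefficient of x vanishes and any exponent is correct. *)
move=> xN; exists `|p|%N; rewrite [in RHS](ext_tens_sum x) scaler_sumr.
apply: eq_bigr => S _; have := xN S; case: ifP => [/eqP <- _|_ ->]; last first.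
  by rewrite !tens0r scaler0.
have -> : (c%:M : 'M[R]_n) = c *: incl_mx id.
  by apply/matrixP=> i j; rewrite !mxE mulr_natr.
by rewrite ext_PhiZ ext_Phi_incl // imset_id tensZl.
Qed.

End ExtLinComp.

(** * Exponent shifts on symmetric and divided powers *)

Section PolyOps.
Variables (R : comNzRingType) (n : nat).
Implicit Types (k l : 'I_n) (y : {mpoly R[n]}) (m : 'X_{1..n}).

Lemma mcoeff_div_contract k y m : (div_contract k y)@_m = y@_(m + U_(k)).
Proof.
rewrite /div_contract [LHS]linear_sum /=.
have [ym|ym] := boolP ((m + U_(k))%MM \in msupp y); last first.
  rewrite (memN_msupp_eq0 ym) big1_seq // => m' /andP[m'k m'y].
  rewrite mcoeffZ mcoeffX; case: eqP => [E|]; last by rewrite mulr0.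
  by rewrite -E submK ?lep1mP -?lt0n // m'y in ym.
rewrite big_mkcond (bigD1_seq _ ym) ?msupp_uniq //= mnmDE mnm1E eqxx addn1 /= addmK.
rewrite mcoeffZ mcoeffX eqxx mulr1 big1_seq ?addr0 // => m' /andP[nE m'y].
case: ifP => // m'k; rewrite mcoeffZ mcoeffX; case: eqP => [E|]; last by rewrite mulr0.
by rewrite -E submK ?lep1mP -?lt0n // eqxx in nE.
Qed.

Lemma mcoeff_sym_mulD k y m : (sym_mul k y)@_(m + U_(k)) = y@_m.
Proof. by rewrite /sym_mul mulrC addmC mcoeffMX. Qed.

Lemma mcoeff_sym_mul0 k y m : m k = 0%N -> (sym_mul k y)@_m = 0.
Proof.
move=> mk; rewrite /sym_mul [y]mpolyE mulr_sumr linear_sum big1 //= => m' _.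
rewrite -scalerAr -mpolyXD mcoeffZ mcoeffX; case: eqP => [E|]; last by rewrite mulr0.
by move: mk; rewrite -E mnmDE mnm1E eqxx.
Qed.

Lemma sym_mul_is_linear k : linear (@sym_mul R n k).
Proof. by move=> c x y; rewrite /sym_mul mulrDr -scalerAr. Qed.

HB.instance Definition _ k := GRing.isLinear.Build R {mpoly R[n]} {mpoly R[n]} _
  (@sym_mul R n k) (sym_mul_is_linear k).

Lemma div_contract_is_linear k : linear (@div_contract R n k).
Proof.
by move=> c x y; apply/mpolyP=> m; rewrite !(mcoeff_div_contract, mcoeffD, mcoeffZ).
Qed.

HB.instance Definition _ k := GRing.isLinear.Build R {mpoly R[n]} {mpoly R[n]} _
  (@div_contract R n k) (div_contract_is_linear k).

Lemma sym_mulC k l y : sym_mul k (sym_mul l y) = sym_mul l (sym_mul k y).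
Proof. by rewrite /sym_mul mulrCA. Qed.

Lemma div_contractC k l y : div_contract k (div_contract l y) = div_contract l (div_contract k y).
Proof. by apply/mpolyP=> m; rewrite !mcoeff_div_contract -!addmA (addmC U_(k))%MM. Qed.

(** A derivative would give a factor here; the divided power action is a pure shift of exponents,
    which keeps the homotopies free of denominators over any ring. *)
Lemma div_contract_sym_mul k y : div_contract k (sym_mul k y) = y.
Proof. by apply/mpolyP=> m; rewrite mcoeff_div_contract mcoeff_sym_mulD. Qed.

Lemma div_contract_sym_mulC k l y : k != l ->
  div_contract k (sym_mul l y) = sym_mul l (div_contract k y).
Proof.
move=> kl; apply/mpolyP=> m; rewrite mcoeff_div_contract.
have [ml|ml] := posnP (m l).
  by rewrite !mcoeff_sym_mul0 // mnmDE mnm1E (negbTE kl) addn0.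
rewrite -(submK (m := U_(l)) (m' := m)) ?lep1mP -?lt0n // -addmA (addmC U_(l))%MM addmA.
by rewrite !mcoeff_sym_mulD mcoeff_div_contract.
Qed.

Lemma degree_partP q y : degree_part q y <-> (forall m, y@_m != 0 -> (mdeg m)%:Z = q).
Proof.
case: q => q /=; last first.
  split=> [-> m|h]; first by rewrite mcoeff0 eqxx.
  by apply/mpolyP=> m; rewrite mcoeff0; apply/eqP; apply: contraT => /h.
split=> [yq m ym|h]; first by congr Posz; apply: (dhomog_mf yq); rewrite mcoeff_msupp.
by apply/dhomogP => m; rewrite mcoeff_msupp => /h[].
Qed.

Lemma submod_degree_part q : submod (@degree_part R n q).
Proof.
split=> [|x y /degree_partP xq /degree_partP yq|c x /degree_partP xq]; apply/degree_partP => m.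
- by rewrite mcoeff0 eqxx.
- rewrite mcoeffD; have [->|/xq//] := eqVneq x@_m 0.
  by rewrite add0r => /yq.
by rewrite mcoeffZ; have [->|/xq//] := eqVneq x@_m 0; rewrite mulr0 eqxx.
Qed.

Lemma degree_part_sym_mul k q y : degree_part q y -> degree_part (q + 1) (sym_mul k y).
Proof.
move=> /degree_partP yq; apply/degree_partP => m.
have [mk|mk] := posnP (m k); first by rewrite mcoeff_sym_mul0 ?eqxx.
rewrite -(submK (m := U_(k)) (m' := m)) ?lep1mP -?lt0n //.
by rewrite mcoeff_sym_mulD mdegD mdeg1 => /yq <-.
Qed.

Lemma degree_part_div_contract k q y : degree_part q y -> degree_part (q - 1) (div_contract k y).
Proof.
move=> /degree_partP yq; apply/degree_partP => m.
by rewrite mcoeff_div_contract => /yq; rewrite mdegD mdeg1 => <-; rewrite PoszD addrK.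
Qed.

Lemma div_contract_eq0 y m : (forall k, div_contract k y = 0) -> m != 0%MM -> y@_m = 0.
Proof.
move=> y0; rewrite -mdeg_eq0 mdegE sum_nat_eq0 negb_forall => /existsP[k mk].
rewrite -(submK (m := U_(k)) (m' := m)) ?lep1mP //.
by rewrite -mcoeff_div_contract y0 mcoeff0.
Qed.

End PolyOps.

(** * Contractions of Koszul-type differentials *)

Section KoszulContraction.
Variables (R : comNzRingType) (M : lmodType R) (g : nat).
Variables (u v B C : 'I_g -> {linear M -> M}).
Implicit Types (k l : 'I_g) (x : M) (s : seq 'I_g).

(** The relations between multiplications and contractions by basis vectors. They are symmetric in u
    and v, so one homotopy serves both [kappa], where u contracts, and [eta], where u multiplies. *)
Definition clifford : Prop :=
  [/\ forall k x, u k (u k x) = 0, forall k x, v k (v k x) = 0,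
      forall k l x, k != l -> u k (u l x) = - u l (u k x),
      forall k l x, k != l -> v k (v l x) = - v l (v k x)
    & (forall k l x, k != l -> u k (v l x) = - v l (u k x)) /\
      (forall k x, u k (v k x) + v k (u k x) = x)].

Definition commuting : Prop :=
  [/\ forall k l x, B k (B l x) = B l (B k x),
      forall k l x, C k (C l x) = C l (C k x),
      forall k l x, k != l -> B k (C l x) = C l (B k x),
      forall k l x, B k (u l x) = u l (B k x) /\ B k (v l x) = v l (B k x)
    & forall k l x, C k (u l x) = u l (C k x) /\ C k (v l x) = v l (C k x)].

Hypotheses (cliff : clifford) (comm : commuting).

Definition koszul x := \sum_l B l (u l x).

Lemma koszul_is_linear : linear koszul.
Proof.
move=> c x y; rewrite /koszul scaler_sumr -big_split; apply: eq_bigr => l _ /=.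
by rewrite !linearP.
Qed.

HB.instance Definition _ := GRing.isLinear.Build R M M _ koszul koszul_is_linear.

Lemma koszul_sq x : koszul (koszul x) = 0.
Proof.
have [uu0 _ ua _ _] := cliff; have [BB _ _ Bu _] := comm.
rewrite /koszul; under eq_bigr => k _ do rewrite !linear_sum /=.
apply: sum_anti_eq0 => [k|k l kl]; rewrite -!(Bu _ _ _).1.
  by rewrite uu0 !linear0.
by rewrite ua // !linearN BB.
Qed.

(* The other summands of the differential anticommute with [khom l], which is
   therefore a homotopy from the identity to [kproj l] for the whole differential.
   The product [kE] of the [kproj l] kills everything but the constants. *)
Definition khom l x := C l (v l x).
Definition kproj l x := x - (B l (u l (khom l x)) + khom l (B l (u l x))).

Fixpoint kH s x := if s is l :: s' then khom l x + kH s' (kproj l x) else 0.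
Fixpoint kE s x := if s is l :: s' then kE s' (kproj l x) else x.

Lemma khom_is_linear l : linear (khom l).
Proof. by move=> c x y; rewrite /khom !linearP. Qed.

HB.instance Definition _ l := GRing.isLinear.Build R M M _ (khom l) (khom_is_linear l).

Lemma kproj_is_linear l : linear (kproj l).
Proof.
move=> c x y; rewrite /kproj !linearP /=.
by rewrite [in X in _ - X]addrACA -scalerDr opprD addrACA -scalerBr.
Qed.

HB.instance Definition _ l := GRing.isLinear.Build R M M _ (kproj l) (kproj_is_linear l).

Lemma kH_is_linear s : linear (kH s).
Proof.
elim: s => [|l s IHs] c x y /=; first by rewrite scaler0 addr0.
by rewrite !linearP IHs /= addrACA -scalerDr.
Qed.

HB.instance Definition _ s := GRing.isLinear.Build R M M _ (kH s) (kH_is_linear s).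

Lemma khom_homotopy l x : koszul (khom l x) + khom l (koszul x) = x - kproj l x.
Proof.
have [_ _ _ _ [uv _]] := cliff; have [_ _ BC Bu Cu] := comm.
rewrite /kproj subKr {1 2}/koszul linear_sum -big_split (bigD1 l) //=.
rewrite big1 ?addr0 // => m ml.
rewrite /khom -(Cu l m _).1 -(Bu m l _).2 -(BC m l) // -!linearD uv //.
by rewrite addNr !linear0.
Qed.

(** By [khom_homotopy], [kproj l x] differs from the cycle x by a boundary and is again a cycle, so
    the one-variable homotopies can be applied in succession. *)
Lemma koszul_cycle s x : koszul x = 0 -> x = koszul (kH s x) + kE s x.
Proof.
elim: s x => [|l s IHs] x dx /=; first by rewrite linear0 add0r.
have E := khom_homotopy l x; rewrite dx linear0 addr0 in E.
rewrite linearD /= -addrA -IHs; last first.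
  have /(congr1 koszul) := E; rewrite koszul_sq linearB /= dx sub0r.
  by move/esym/eqP; rewrite oppr_eq0 => /eqP.
by rewrite E subrK.
Qed.

Lemma kHE_stable s (P P' : M -> Prop) : submod P' ->
  (forall l x, P x -> P' (khom l x)) -> (forall l x, P x -> P (kproj l x)) ->
  forall x, P x -> P' (kH s x) /\ P (kE s x).
Proof.
move=> [P'0 P'D _] hP eP; elim: s => [|l s IHs] x Px //=.
by have [] := IHs _ (eP l _ Px); split=> //; apply: P'D => //; apply: hP.
Qed.

(** W need not commute with the [kproj m]: once [kproj l] has landed in the kernel of W, it is
    enough that the later factors preserve this kernel. *)
Lemma kE_killed (W : {linear M -> M}) l s : l \in s ->
  (forall x, W (kproj l x) = 0) ->
  (forall m x, W x = 0 -> W (kproj m x) = 0) -> forall x, W (kE s x) = 0.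
Proof.
move=> + Wl Wm; have Ws s' x : W x = 0 -> W (kE s' x) = 0.
  by elim: s' x => //= m s' IHs x /(Wm m)/IHs.
elim: s => //= m s IHs; rewrite inE => /orP[/eqP <- x|/IHs//]; exact/Ws/Wl.
Qed.

(** The case of symmetric powers. Here [kproj l] is the product of the commuting idempotents
    [1 - B l C l] and [u l v l], so its image is killed by both [C l] and [u l]. *)
Lemma kprojE_CB l x : (forall x, C l (B l x) = x) ->
  kproj l x = u l (v l x) - B l (C l (u l (v l x))).
Proof.
move=> CB; have [_ _ _ _ [_ uv]] := cliff; have [_ _ _ Bu Cu] := comm.
rewrite /kproj /khom -(Bu l l _).2 CB -(Cu l l _).1 opprD addrCA addrC.
by congr (_ - _); rewrite -{1}(uv l x) addrK.
Qed.

(** The case of divided powers, with the idempotents [1 - C l B l] and [v l u l]; the image is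
    killed by [B l] and [v l]. *)
Lemma kprojE_BC l x : (forall x, B l (C l x) = x) ->
  kproj l x = v l (u l x) - C l (B l (v l (u l x))).
Proof.
move=> BC; have [_ _ _ _ [_ uv]] := cliff; have [_ _ _ Bu Cu] := comm.
rewrite /kproj /khom -(Cu l l _).1 BC -(Bu l l _).2 opprD addrA.
by congr (_ - _); rewrite -{1}(uv l x) addrC addKr.
Qed.

Lemma kE_killed_C l x : (forall l x, C l (B l x) = x) ->
  C l (kE (enum 'I_g) x) = 0.
Proof.
move=> CB; have [_ CC BC Bu Cu] := comm.
apply: (kE_killed (l := l)); first by rewrite mem_enum.
  by move=> y; rewrite kprojE_CB // linearB CB subrr.
move=> m y Cy; have [->|ml] := eqVneq m l.
  by rewrite kprojE_CB // linearB CB subrr.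
by rewrite kprojE_CB // linearB -(BC m l) // (CC l m) (Cu l m _).1 (Cu l m _).2 Cy !(linear0, oppr0, addr0).
Qed.

Lemma kE_killed_u l x : (forall l x, C l (B l x) = x) ->
  u l (kE (enum 'I_g) x) = 0.
Proof.
move=> CB; have [uu _ ua _ [uv _]] := cliff; have [_ CC BC Bu Cu] := comm.
apply: (kE_killed (l := l)); first by rewrite mem_enum.
  by move=> y; rewrite kprojE_CB // linearB -(Bu l l _).1 -(Cu l l _).1 uu !(linear0, oppr0, addr0).
move=> m y uy; rewrite kprojE_CB // linearB -(Bu m l _).1 -(Cu m l _).1.
have [->|lm] := eqVneq l m; first by rewrite uu !(linear0, oppr0, addr0).
by rewrite (ua l m) // (uv l m) // uy !(linear0, linearN, oppr0, addr0).
Qed.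

Lemma kE_killed_B l x : (forall l x, B l (C l x) = x) ->
  B l (kE (enum 'I_g) x) = 0.
Proof.
move=> BC1; have [BB CC BC Bu Cu] := comm.
apply: (kE_killed (l := l)); first by rewrite mem_enum.
  by move=> y; rewrite kprojE_BC // linearB BC1 subrr.
move=> m y By; have [->|ml] := eqVneq m l.
  by rewrite kprojE_BC // linearB BC1 subrr.
rewrite kprojE_BC // linearB (BC l m) 1?eq_sym // (BB l m) (Bu l m _).2 (Bu l m _).1.
by rewrite By !(linear0, oppr0, addr0).
Qed.

Lemma kE_killed_v l x : (forall l x, B l (C l x) = x) ->
  v l (kE (enum 'I_g) x) = 0.
Proof.
move=> BC1; have [_ vv _ va [uv _]] := cliff; have [_ CC BC Bu Cu] := comm.
apply: (kE_killed (l := l)); first by rewrite mem_enum.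
  by move=> y; rewrite kprojE_BC // linearB -(Cu l l _).2 -(Bu l l _).2 vv !(linear0, oppr0, addr0).
move=> m y vy; rewrite kprojE_BC // linearB -(Cu m l _).2 -(Bu m l _).2.
have [->|lm] := eqVneq l m; first by rewrite vv !(linear0, oppr0, addr0).
have vu z : v l (u m z) = - u m (v l z) by rewrite (uv m l) ?opprK // eq_sym.
by rewrite (va l m) // vu vy !(linear0, linearN, oppr0, addr0).
Qed.

End KoszulContraction.

Section CliffordMaps.
Variables (R : comNzRingType) (n : nat).

Lemma ext_map_cre (M N : lmodType R) (h : {linear M -> N}) b k (x : ext n M) :
  ext_map h (cre b k x) = cre b k (ext_map h x).
Proof.
by apply/ffunP=> S; rewrite !ffunE; case: ifP; rewrite ?linear0 // linearZ.
Qed.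

Lemma ext_map_ann (M N : lmodType R) (h : {linear M -> N}) b k (x : ext n M) :
  ext_map h (ann b k x) = ann b k (ext_map h x).
Proof.
by apply/ffunP=> S; rewrite !ffunE; case: ifP; rewrite ?linear0 // linearZ.
Qed.

Lemma ext_map_wedge (M N : lmodType R) (h : {linear M -> N}) (x : ext n M) w :
  ext_map h (wedge x w) = wedge (ext_map h x) w.
Proof.
apply/ffunP=> S; rewrite !ffunE linear_sum; apply: eq_bigr => A _ /=.
by rewrite linearZ ffunE.
Qed.

Lemma ext_part_cre (M : lmodType R) (N : M -> Prop) p b k (x : ext n M) :
  submod N -> ext_part p N x -> ext_part (p + 1) N (cre b k x).
Proof.
move=> [N0 _ NZ] xN S; rewrite ffunE; case: (boolP (k \in S)) => kS; last by case: ifP.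
have := xN (S :\ k); rewrite (cardsD1 k S) kS addnC PoszD (inj_eq (addIr _)).
by case: ifP => _; [exact: NZ | move->; rewrite scaler0].
Qed.

Lemma ext_part_ann (M : lmodType R) (N : M -> Prop) p b k (x : ext n M) :
  submod N -> ext_part p N x -> ext_part (p - 1) N (ann b k x).
Proof.
move=> [N0 _ NZ] xN S; rewrite ffunE; case: (boolP (k \in S)) => kS; first by case: ifP.
have := xN (k |: S); rewrite cardsU1 kS addnC PoszD -subr_eq.
by case: ifP => _; [exact: NZ | move->; rewrite scaler0].
Qed.

End CliffordMaps.

Section Instances.
Variables (R : comNzRingType) (f g : nat) (N : lmodType R).
Variables (b : bool) (p : 'I_g -> 'I_f) (p_inj : injective p).

Definition lcre l : {linear ext f N -> ext f N} := cre b (p l).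
Definition lann l : {linear ext f N -> ext f N} := ann b (p l).

Lemma clifford_cre : clifford lcre lann.
Proof.
split; rewrite /lcre /lann /=.
- by move=> k x; rewrite cre_cre.
- by move=> k x; rewrite ann_ann.
- by move=> k l x kl; rewrite cre_anti ?(inj_eq p_inj).
- by move=> k l x kl; rewrite ann_anti ?(inj_eq p_inj).
split=> [k l x kl|k x]; last by rewrite cre_annD.
by rewrite cre_ann_anti ?(inj_eq p_inj).
Qed.

Lemma clifford_ann : clifford lann lcre.
Proof.
have [cc aa ca an [ca1 ca2]] := clifford_cre.
split=> //; split=> [k l x kl|k x]; last by rewrite addrC.
by rewrite ca1 ?opprK // eq_sym.
Qed.

Variables (X D : 'I_g -> {linear N -> N}).

Definition shifts : Prop :=
  [/\ forall k l x, X k (X l x) = X l (X k x),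
      forall k l x, D k (D l x) = D l (D k x)
    & forall k l x, k != l -> X k (D l x) = D l (X k x)].

Definition lext n (h : 'I_g -> {linear N -> N}) l : {linear ext n N -> ext n N} :=
  ext_map (h l).

Lemma commuting_cre : shifts -> commuting lcre lann (lext f X) (lext f D).
Proof.
case=> XX DD XD; split; rewrite /lext /=.
- by move=> k l x; apply/ffunP=> S; rewrite !ffunE.
- by move=> k l x; apply/ffunP=> S; rewrite !ffunE.
- by move=> k l x kl; apply/ffunP=> S; rewrite !ffunE XD.
- by move=> k l x; rewrite /lcre /lann /= ext_map_cre ext_map_ann.
by move=> k l x; rewrite /lcre /lann /= ext_map_cre ext_map_ann.
Qed.

Lemma commuting_ann : shifts -> commuting lann lcre (lext f X) (lext f D).
Proof. by move/commuting_cre => [XX DD XD uX uD]; split=> // k l x; split; apply uX || apply uD. Qed.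

Lemma shifts_lext n : shifts ->
  [/\ forall k l x, lext n X k (lext n X l x) = lext n X l (lext n X k x),
      forall k l x, lext n D k (lext n D l x) = lext n D l (lext n D k x)
    & forall k l x, k != l -> lext n X k (lext n D l x) = lext n D l (lext n X k x)].
Proof.
case=> XX DD XD; split; rewrite /lext /=.
- by move=> k l x; apply/ffunP=> S; rewrite !ffunE.
- by move=> k l x; apply/ffunP=> S; rewrite !ffunE.
by move=> k l x kl; apply/ffunP=> S; rewrite !ffunE XD.
Qed.

End Instances.

(** * Contractions of kappa and eta *)

Section HookMaps.
Variables (R : comNzRingType) (n : nat).
Implicit Types (z : ext n {mpoly R[n]}).

Definition lmulX l : {linear {mpoly R[n]} -> {mpoly R[n]}} := @sym_mul R n l.
Definition ldivX l : {linear {mpoly R[n]} -> {mpoly R[n]}} := @div_contract R n l.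

Lemma shifts_sym : shifts lmulX ldivX.
Proof.
split=> [k l x|k l x|k l x kl]; [exact: sym_mulC | exact: div_contractC |].
by rewrite /= div_contract_sym_mulC // eq_sym.
Qed.

Lemma shifts_div : shifts ldivX lmulX.
Proof.
split=> [k l x|k l x|k l x kl]; [exact: div_contractC | exact: sym_mulC |].
exact: div_contract_sym_mulC.
Qed.

Lemma kappaE z :
  kappa z = koszul (lann {mpoly R[n]} false id) (lext n lmulX) z.
Proof. by []. Qed.

Lemma etaE z :
  Defs.eta z = koszul (lcre {mpoly R[n]} true id) (lext n ldivX) z.
Proof.
rewrite /Defs.eta /koszul; apply: eq_bigr => l _; rewrite wedge_vect.
by rewrite /lext /= ext_map_cre.
Qed.

(** Contractions in the two factors together detect everything outside bidegree (0, 0). *)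
Lemma ext_part_eq0 p q b z : (p != 0) || (q != 0) -> ext_part p (degree_part q) z ->
  (forall l, ext_map (ldivX l) z = 0) -> (forall l, ann b l z = 0) -> z = 0.
Proof.
move=> pq zpq Dz az; apply/ffunP=> S; rewrite ffunE.
have [->|S0] := eqVneq S set0; last by apply: (ann_eq0 (b := b)).
have := zpq set0; rewrite cards0; case: ifP => [/eqP p0 /degree_partP zq|//].
apply/mpolyP=> m; rewrite mcoeff0; have [->|m0] := eqVneq m 0%MM.
  apply/eqP; apply: contraT => /zq; rewrite mdeg0 => q0.
  by rewrite -p0 -q0 in pq.
apply: div_contract_eq0 => // k; have /ffunP/(_ set0) := Dz k.
by rewrite !ffunE.
Qed.

Lemma lext_part (N N' : {mpoly R[n]} -> Prop) (h : 'I_n -> {linear {mpoly R[n]} -> {mpoly R[n]}})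
    p l z : (forall y, N y -> N' (h l y)) -> ext_part p N z -> ext_part p N' (lext n h l z).
Proof. exact: ext_part_map. Qed.

Lemma lmulX_part q l (y : {mpoly R[n]}) :
  degree_part q y -> degree_part (q + 1) (lmulX l y).
Proof. exact: degree_part_sym_mul. Qed.

Lemma ldivX_part q l (y : {mpoly R[n]}) :
  degree_part q y -> degree_part (q - 1) (ldivX l y).
Proof. exact: degree_part_div_contract. Qed.

Let submodP p q : submod (@ext_part R n {mpoly R[n]} p (degree_part q)).
Proof. exact/submod_ext_part/submod_degree_part. Qed.

(** A single linear H serves all bidegrees. Linearity lets it act coefficientwise on $\bigwedge F$
    and later yields linear projections onto the hook modules. *)
Lemma kappa_contraction : exists H : {linear ext n {mpoly R[n]} -> ext n {mpoly R[n]}},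
  forall p q z, ext_part p (degree_part q) z ->
    ext_part (p + 1) (degree_part (q - 1)) (H z) /\
    ((p != 0) || (q != 0) -> kappa z = 0 -> kappa (H z) = z).
Proof.
have cliff := clifford_ann {mpoly R[n]} false (@inj_id 'I_n).
have comm := commuting_ann false (@id 'I_n) shifts_sym.
have CB l (x : ext n {mpoly R[n]}) : lext n ldivX l (lext n lmulX l x) = x.
  by apply/ffunP=> S; rewrite /lext !ffunE /= div_contract_sym_mul.
exists (kH (lann _ false id) (lcre _ false id) (lext n lmulX) (lext n ldivX) (enum 'I_n)).
move=> p q z zpq.
have [l x xpq|l x xpq|zH zE] := @kHE_stable _ _ _ (lann _ false id)
    (lcre _ false id) (lext n lmulX) (lext n ldivX) (enum 'I_n)
    (ext_part p (degree_part q)) (ext_part (p + 1) (degree_part (q - 1)))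
    (submodP _ _) _ _ z zpq.
- apply: lext_part (@ldivX_part q l) _.
  by apply: ext_part_cre => //; apply: submod_degree_part.
- rewrite (kprojE_CB cliff comm _ (CB l)); have [_ sD sZ] := submodP p q.
  have xp : ext_part p (degree_part q) (lann {mpoly R[n]} false id l (lcre _ false id l x)).
    rewrite -[p](addrK 1); apply: ext_part_ann; first exact: submod_degree_part.
    by apply: ext_part_cre => //; apply: submod_degree_part.
  rewrite -scaleN1r; apply: sD => //; apply: sZ.
  apply: (lext_part (N := degree_part (q - 1))) => [y yq|].
    by rewrite -[q](subrK 1); apply: lmulX_part.
  exact: lext_part (@ldivX_part q l) _.
split=> // pq; rewrite !kappaE => dz.
rewrite {2}[z](koszul_cycle cliff comm (enum 'I_n)) //.
rewrite (ext_part_eq0 (b := false) pq zE) ?addr0 // => l.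
  exact: (kE_killed_C cliff comm).
exact: (kE_killed_u cliff comm).
Qed.

Lemma eta_contraction : exists H : {linear ext n {mpoly R[n]} -> ext n {mpoly R[n]}},
  forall p q z, ext_part p (degree_part q) z ->
    ext_part (p - 1) (degree_part (q + 1)) (H z) /\
    ((p != 0) || (q != 0) -> Defs.eta z = 0 -> Defs.eta (H z) = z).
Proof.
have cliff := clifford_cre {mpoly R[n]} true (@inj_id 'I_n).
have comm := commuting_cre true (@id 'I_n) shifts_div.
have BC l (x : ext n {mpoly R[n]}) : lext n ldivX l (lext n lmulX l x) = x.
  by apply/ffunP=> S; rewrite /lext !ffunE /= div_contract_sym_mul.
exists (kH (lcre _ true id) (lann _ true id) (lext n ldivX) (lext n lmulX) (enum 'I_n)).
move=> p q z zpq.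
have [l x xpq|l x xpq|zH zE] := @kHE_stable _ _ _ (lcre _ true id)
    (lann _ true id) (lext n ldivX) (lext n lmulX) (enum 'I_n)
    (ext_part p (degree_part q)) (ext_part (p - 1) (degree_part (q + 1)))
    (submodP _ _) _ _ z zpq.
- apply: lext_part (@lmulX_part q l) _.
  by apply: ext_part_ann => //; apply: submod_degree_part.
- rewrite (kprojE_BC cliff comm _ (BC l)); have [_ sD sZ] := submodP p q.
  have xp : ext_part p (degree_part q) (lann {mpoly R[n]} true id l (lcre _ true id l x)).
    rewrite -[p](addrK 1); apply: ext_part_ann; first exact: submod_degree_part.
    by apply: ext_part_cre => //; apply: submod_degree_part.
  rewrite -scaleN1r; apply: sD => //; apply: sZ.
  apply: (lext_part (N := degree_part (q - 1))) => [y yq|].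
    by rewrite -[q](subrK 1); apply: lmulX_part.
  exact: lext_part (@ldivX_part q l) _.
split=> // pq; rewrite !etaE => dz.
rewrite {2}[z](koszul_cycle cliff comm (enum 'I_n)) //.
rewrite (ext_part_eq0 (b := true) pq zE) ?addr0 // => l.
  exact: (kE_killed_B cliff comm).
exact: (kE_killed_v cliff comm).
Qed.

End HookMaps.

(** * The differentials of the hook complex *)

Section GeneralMap.
Variables (R : comNzRingType) (f g : nat) (A : 'M[R]_(f, g)).
Notation mp := {mpoly R[g]}.
Implicit Types (u z : ext f (ext g mp)) (x y : ext f R^o) (T : {set 'I_g}).

Lemma kappa_is_linear : linear (@kappa R g).
Proof.
exact: (koszul_is_linear (lann mp false (@id 'I_g)) (lext g (@lmulX R g))).
Qed.

HB.instance Definition _ := GRing.isLinear.Build R (ext g mp) (ext g mp) _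
  (@kappa R g) kappa_is_linear.

Lemma eta_is_linear : linear (@Defs.eta R g).
Proof.
move=> c x y; rewrite !etaE.
exact: (koszul_is_linear (lcre mp true (@id 'I_g)) (lext g (@ldivX R g))).
Qed.

HB.instance Definition _ := GRing.isLinear.Build R (ext g mp) (ext g mp) _
  (@Defs.eta R g) eta_is_linear.

Lemma kappa_sq (z : ext g mp) : kappa (kappa z) = 0.
Proof.
exact: (koszul_sq (clifford_ann _ false (@inj_id 'I_g))
  (commuting_ann false (@id 'I_g) (shifts_sym R g))).
Qed.

Lemma eta_sq (z : ext g mp) : Defs.eta (Defs.eta z) = 0.
Proof.
rewrite !etaE; exact: (koszul_sq (clifford_cre _ true (@inj_id 'I_g))
  (commuting_cre true (@id 'I_g) (shifts_div R g))).
Qed.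

Lemma kappa_part s q (z : ext g mp) : ext_part s (degree_part q) z ->
  ext_part (s - 1) (degree_part (q + 1)) (kappa z).
Proof.
move=> zs; apply: submod_sum => [|l _].
  exact/submod_ext_part/submod_degree_part.
apply: (ext_part_map (N := degree_part q)) => [y|]; first exact: degree_part_sym_mul.
by rewrite contractE; apply: ext_part_ann => //; apply: submod_degree_part.
Qed.

Lemma eta_part s q (z : ext g mp) : ext_part s (degree_part q) z ->
  ext_part (s + 1) (degree_part (q - 1)) (Defs.eta z).
Proof.
move=> zs; apply: submod_sum => [|l _].
  exact/submod_ext_part/submod_degree_part.
rewrite wedge_vect; apply: ext_part_cre; first exact: submod_degree_part.
by apply: (ext_part_map (N := degree_part q)) => // y; exact: degree_part_div_contract.
Qed.

Lemma kappa_mulX l (z : ext g mp) :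
  kappa (ext_map (lmulX R l) z) = ext_map (lmulX R l) (kappa z).
Proof.
rewrite /kappa linear_sum; apply: eq_bigr => k _ /=.
rewrite !contractE -(ext_map_ann (lmulX R l)).
by apply/ffunP=> S; rewrite !ffunE /= sym_mulC.
Qed.

Lemma eta_divX l (z : ext g mp) :
  Defs.eta (ext_map (ldivX R l) z) = ext_map (ldivX R l) (Defs.eta z).
Proof.
rewrite /Defs.eta linear_sum; apply: eq_bigr => k _ /=.
rewrite (ext_map_wedge (ldivX R l)); congr wedge.
by apply/ffunP=> S; rewrite !ffunE /= div_contractC.
Qed.

(** The component $\bigwedge^rF\otimes\bigwedge^sG\otimes\operatorname{Sym}_qG$, or its dual
    analogue with divided powers: one spot of the double complex with differentials [Kos_Phi] and
    [kappa], or [eta_Phi] and [eta]. *)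
Definition tri r s q := @ext_part R f _ r (@ext_part R g mp s (@degree_part R g q)).

Lemma submod_tri r s q : submod (tri r s q).
Proof. exact/submod_ext_part/submod_ext_part/submod_degree_part. Qed.

Lemma tri0 r s q : tri r s q 0.
Proof. by case: (submod_tri r s q). Qed.

Lemma triB r s q z u : tri r s q z -> tri r s q u -> tri r s q (z - u).
Proof.
have [_ D Z] := submod_tri r s q => hz hu.
by rewrite -scaleN1r; apply/D/Z.
Qed.

Lemma tri_kappa r s q z : tri r s q z -> tri r (s - 1) (q + 1) (ext_map (@kappa R g) z).
Proof. by apply: ext_part_map => y; exact: kappa_part. Qed.

Lemma tri_eta r s q z : tri r s q z -> tri r (s + 1) (q - 1) (ext_map (@Defs.eta R g) z).
Proof. by apply: ext_part_map => y; exact: eta_part. Qed.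

Lemma tri_neg r s q z : (s < 0) || (q < 0) || (r < 0) -> tri r s q z -> z = 0.
Proof.
move=> neg zt; apply/ffunP=> S; rewrite ffunE; have := zt S; case: ifP => // /eqP rE.
move=> zS; apply/ffunP=> T; rewrite ffunE; have := zS T; case: ifP => // /eqP sE.
by move: neg; rewrite -sE -rE /= orbF; case: q {zt zS} => q //.
Qed.

Lemma Kos_is_linear : linear (Kos_Phi A).
Proof.
move=> c z u; rewrite /Kos_Phi scaler_sumr -big_split; apply: eq_bigr => l _ /=.
have := linearP (ext_map (lext g (@lmulX R g) l)) c z u; rewrite /lext /= => ->.
by rewrite wedgeDl wedgeZl.
Qed.

HB.instance Definition _ := GRing.isLinear.Build R
  (ext f (ext g mp)) (ext f (ext g mp)) _ (Kos_Phi A) Kos_is_linear.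

Lemma eta_Phi_is_linear : linear (eta_Phi A).
Proof.
move=> c z u; rewrite /eta_Phi scaler_sumr -big_split; apply: eq_bigr => l _ /=.
have := linearP (ext_map (lext g (@ldivX R g) l)) c z u; rewrite /lext /= => ->.
by rewrite wedgeDl wedgeZl.
Qed.

HB.instance Definition _ := GRing.isLinear.Build R
  (ext f (ext g mp)) (ext f (ext g mp)) _ (eta_Phi A) eta_Phi_is_linear.

Lemma Kos_PhiB z u : Kos_Phi A (z - u) = Kos_Phi A z - Kos_Phi A u.
Proof. exact: linearB. Qed.

Lemma eta_PhiB z u : eta_Phi A (z - u) = eta_Phi A z - eta_Phi A u.
Proof. exact: linearB. Qed.

Lemma Phi_basis_part l : ext_part 1 (fun _ : R^o => True) (Phi_basis A l).
Proof.
by have := ext_part_Phi A [set l]; rewrite cards1 /ext_Phi enum_set1 big_seq1.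
Qed.

Lemma tri_Kos r s q z : tri r s q z -> tri (r + 1) s (q + 1) (Kos_Phi A z).
Proof.
move=> zt; apply: submod_sum => [|l _]; first exact: submod_tri.
apply: ext_part_wedge; last exact: Phi_basis_part.
  exact/submod_ext_part/submod_degree_part.
apply: (ext_part_map (h := lext g (@lmulX R g) l)) zt => y.
by apply: ext_part_map => w; exact: degree_part_sym_mul.
Qed.

Lemma tri_eta_Phi r s q z : tri r s q z -> tri (r + 1) s (q - 1) (eta_Phi A z).
Proof.
move=> zt; apply: submod_sum => [|l _]; first exact: submod_tri.
apply: ext_part_wedge; last exact: Phi_basis_part.
  exact/submod_ext_part/submod_degree_part.
apply: (ext_part_map (h := lext g (@ldivX R g) l)) zt => y.
by apply: ext_part_map => w; exact: degree_part_div_contract.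
Qed.

Lemma Kos_kappa z :
  Kos_Phi A (ext_map (@kappa R g) z) = ext_map (@kappa R g) (Kos_Phi A z).
Proof.
rewrite /Kos_Phi linear_sum; apply: eq_bigr => l _ /=; rewrite ext_map_wedge.
by congr wedge; apply/ffunP=> S; rewrite !ffunE; exact/esym/kappa_mulX.
Qed.

Lemma eta_Phi_eta z :
  eta_Phi A (ext_map (@Defs.eta R g) z) = ext_map (@Defs.eta R g) (eta_Phi A z).
Proof.
rewrite /eta_Phi linear_sum; apply: eq_bigr => l _ /=; rewrite ext_map_wedge.
by congr wedge; apply/ffunP=> S; rewrite !ffunE; exact/esym/eta_divX.
Qed.

Lemma wedge_Phi_sq (M : lmodType R) (x : ext f M) l :
  wedge (wedge x (Phi_basis A l)) (Phi_basis A l) = 0.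
Proof. by rewrite /Phi_basis wedge_vect_sq. Qed.

Lemma wedge_Phi_anti (M : lmodType R) (x : ext f M) k l :
  wedge (wedge x (Phi_basis A k)) (Phi_basis A l) =
  - wedge (wedge x (Phi_basis A l)) (Phi_basis A k).
Proof. by rewrite /Phi_basis wedge_vect_anti. Qed.

Lemma Kos_sq z : Kos_Phi A (Kos_Phi A z) = 0.
Proof.
pose X l : {linear ext f (ext g mp) -> ext f (ext g mp)} := ext_map (lext g (@lmulX R g) l).
have wX l w u : X l (wedge u w) = wedge (X l u) w by apply: ext_map_wedge.
transitivity (\sum_l \sum_k wedge (wedge (X l (X k z)) (Phi_basis A k)) (Phi_basis A l)).
  apply: eq_bigr => l _; rewrite -wedge_suml; congr wedge.
  by rewrite -[LHS]/(X l _) /Kos_Phi linear_sum; apply: eq_bigr => k _; rewrite wX.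
apply: sum_anti_eq0 => [l|k l kl]; first by rewrite wedge_Phi_sq.
have XC : X k (X l z) = X l (X k z).
  by apply/ffunP=> S; apply/ffunP=> T; rewrite /= !ffunE /= sym_mulC.
by rewrite wedge_Phi_anti XC.
Qed.

Lemma eta_Phi_sq z : eta_Phi A (eta_Phi A z) = 0.
Proof.
pose X l : {linear ext f (ext g mp) -> ext f (ext g mp)} := ext_map (lext g (@ldivX R g) l).
have wX l w u : X l (wedge u w) = wedge (X l u) w by apply: ext_map_wedge.
transitivity (\sum_l \sum_k wedge (wedge (X l (X k z)) (Phi_basis A k)) (Phi_basis A l)).
  apply: eq_bigr => l _; rewrite -wedge_suml; congr wedge.
  by rewrite -[LHS]/(X l _) /eta_Phi linear_sum; apply: eq_bigr => k _; rewrite wX.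
apply: sum_anti_eq0 => [l|k l kl]; first by rewrite wedge_Phi_sq.
have XC : X k (X l z) = X l (X k z).
  by apply/ffunP=> S; apply/ffunP=> T; rewrite /= !ffunE /= div_contractC.
by rewrite wedge_Phi_anti XC.
Qed.

End GeneralMap.

(** * The two maps at the middle term *)

Section MiddleMaps.
Variables (R : comNzRingType) (f g : nat) (A : 'M[R]_(f, g)).
Notation mp := {mpoly R[g]}.
Implicit Types (u z : ext f (ext g mp)) (x y : ext f R^o) (T : {set 'I_g}).

(** For $k=\mathfrak g+1-a$ this lifts $d_{i+1}$ along [kappa] to
    $\bigwedge^kG\otimes\operatorname{Sym}_0G$. The other values of k occur in the induction of the
    chase. *)
Definition Psi (k : nat) x : ext f (ext g mp) :=
  \sum_(T : {set 'I_g} | #|T| == k)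
     tens (wedge x (ext_Phi A T)) (tens (ext_basis R T) 1).

Definition const_coef T (y : ext g mp) : R^o := (y T)@_0%MM.

Lemma const_coef_is_linear T : linear (const_coef T).
Proof. by move=> c y z; rewrite /const_coef !ffunE mcoeffD mcoeffZ. Qed.

HB.instance Definition _ T := GRing.isLinear.Build R (ext g mp) R^o _
  (const_coef T) (const_coef_is_linear T).

Lemma d_high_midE z :
  d_high_mid A z = \sum_T wedge (ext_map (const_coef T) z) (ext_Phi A T).
Proof. by []. Qed.

Lemma d_high_mid_is_linear : linear (d_high_mid A).
Proof.
move=> c z u; rewrite !d_high_midE scaler_sumr -big_split; apply: eq_bigr => T _ /=.
by rewrite linearP wedgeDl wedgeZl.
Qed.

HB.instance Definition _ := GRing.isLinear.Build R
  (ext f (ext g mp)) (ext f R^o) _ (d_high_mid A) d_high_mid_is_linear.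

Lemma Psi_is_linear k : linear (Psi k).
Proof.
move=> c x y; rewrite /Psi scaler_sumr -big_split; apply: eq_bigr => T _ /=.
rewrite wedgeDl wedgeZl; apply/ffunP=> S; rewrite !ffunE.
by rewrite scalerDl scalerA.
Qed.

HB.instance Definition _ k := GRing.isLinear.Build R
  (ext f R^o) (ext f (ext g mp)) _ (Psi k) (Psi_is_linear k).

Lemma ext_map_tens (M N : lmodType R) (h : {linear M -> N}) x (m : M) :
  ext_map h (tens x m) = tens x (h m).
Proof. by apply/ffunP=> S; rewrite !ffunE linearZ. Qed.

Lemma d_mid_lowE (k : nat) (a : int) x : g%:Z + 1 - a = k%:Z ->
  d_mid_low A a x = ext_map (@kappa R g) (Psi k x).
Proof.
move=> E; rewrite /d_mid_low E /Psi linear_sum; apply: eq_bigr => T _ /=.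
by rewrite ext_map_tens.
Qed.

Lemma tri_tens r s q x (y : ext g mp) : ext_part r (fun _ => True) x ->
  ext_part s (degree_part q) y -> tri r s q (tens x y).
Proof.
move=> xr ys S; rewrite ffunE; have := xr S; case: ifP => [_ _|_ ->]; last by rewrite scale0r.
by case: (submod_ext_part g s (@submod_degree_part R g q)) => _ _; apply.
Qed.

Lemma unit_part T (y : mp) q : degree_part q y ->
  ext_part #|T| (degree_part q) (tens (ext_basis R T) y).
Proof.
move=> yq S; rewrite !ffunE; case: (S =P T) => [->|_].
  by rewrite eqxx scale1r.
by rewrite scale0r; case: ifP => // _; case: (@submod_degree_part R g q).
Qed.

Lemma degree_part1 : degree_part 0 (1 : mp).
Proof. exact: dhomog1. Qed.

Lemma tri_Psi r k x : ext_part r (fun _ => True) x -> tri (r + k%:Z) k 0 (Psi k x).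
Proof.
move=> xr; apply: submod_sum => [|T /eqP <-]; first exact: submod_tri.
apply: tri_tens; last by apply: unit_part; exact: degree_part1.
by apply: ext_part_wedge => //; exact: ext_part_Phi.
Qed.

Lemma d_high_mid_part r s q z : tri r s q z ->
  ext_part (r + s) (fun _ => True) (d_high_mid A z).
Proof.
move=> zt; rewrite d_high_midE; apply: submod_sum => [|T _].
  exact: submod_ext_part.
have [Ts|Ts] := eqVneq #|T|%:Z s.
  rewrite -Ts; apply: ext_part_wedge => //; last exact: ext_part_Phi.
  by move=> S; have := zt S; rewrite ffunE; case: ifP => // _ ->; rewrite linear0.
have -> : ext_map (const_coef T) z = 0.
  apply/ffunP=> S; rewrite !ffunE /const_coef; have := zt S.
  case: ifP => [_ /(_ T)|_ ->]; last by rewrite ffunE mcoeff0.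
  by rewrite (negbTE Ts) => ->; rewrite mcoeff0.
by rewrite wedge0l; case: (submod_ext_part f (r + s) (@submodT R R^o)).
Qed.

Lemma Psi_wedge k x T : #|T| = k -> Psi k x = 0 -> wedge x (ext_Phi A T) = 0.
Proof.
move=> Tk Px; apply/ffunP=> S; rewrite [RHS]ffunE.
have := congr1 (fun z => const_coef T (z S)) Px; rewrite /Psi sum_ffunE !linear_sum /=.
rewrite (bigD1 T) ?Tk //= big1 => [|T' /andP[_ nT]]; rewrite /const_coef !ffunE.
  rewrite mcoeff0 eqxx scale1r mcoeffZ mcoeff1 eqxx mulr1 addr0 => E.
  exact: E.
by rewrite eq_sym (negbTE nT) scale0r scaler0 mcoeff0.
Qed.

Lemma tri00_Psi r z : tri r 0 0 z ->
  exists2 x, ext_part r (fun _ => True) x & z = Psi 0 x.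
Proof.
move=> zt; exists (ext_map (const_coef set0) z).
  by move=> S; have := zt S; rewrite ffunE; case: ifP => // _ ->; rewrite linear0.
rewrite /Psi (big_pred1 set0) => [|T]; last by rewrite /= cards_eq0.
rewrite ext_Phi0 wedge1r; apply/ffunP=> S; apply/ffunP=> T; rewrite !ffunE /const_coef.
have := zt S; case: ifP => [_ /(_ T)|_ ->]; last first.
  by rewrite !ffunE mcoeff0 scale0r.
case: ifP => [|+ ->]; last first.
  have [->|T0] := eqVneq T set0; first by rewrite cards0.
  by rewrite scale0r scaler0.
rewrite eqz_nat cards_eq0 => /eqP-> /degree_partP z0; rewrite eqxx scale1r.
apply/mpolyP=> m; rewrite mcoeffZ mcoeff1; have [->|m0] := eqVneq m 0%MM.
  by rewrite mulr1.
rewrite mulr0; apply/eqP; apply: contraT => /z0 [].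
by move/eqP; rewrite mdeg_eq0 (negbTE m0).
Qed.

(** Translates between the sign of multiplication from the right, used by [Kos_Phi], and that of
    contraction from the left, used by [kappa]. *)
Lemma ext_sign_compl (k : 'I_g) T : k \notin T ->
  ext_sign R true k T = (-1) ^+ #|T| * ext_sign R false k T.
Proof.
move=> kT; rewrite /ext_sign -(cardsID [set t : 'I_g | bef false k t] T) exprD.
have -> : T :&: [set t | bef false k t] = [set t in T | bef false k t].
  by apply/setP=> t; rewrite !inE.
have -> : T :\: [set t | bef false k t] = [set t in T | bef true k t].
  apply/setP=> t; rewrite !inE /bef andbC -leqNgt leq_eqVlt.
  by case: (k =P t :> nat) => // /val_inj <-; rewrite (negbTE kT).
by rewrite mulrAC -expr2 sqrr_sign mul1r.
Qed.

Lemma ann_unit b k T (y : mp) : ann b k (tens (ext_basis R T) y) =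
  if k \in T then ext_sign R b k T *: tens (ext_basis R (T :\ k)) y else 0.
Proof.
apply/ffunP=> S; rewrite !ffunE; case: (boolP (k \in S)) => kS.
  case: ifP => kT; rewrite !ffunE //; case: eqP => [ST|]; last by rewrite scale0r scaler0.
  by rewrite ST setD11 in kS.
case: ifP => kT; rewrite !ffunE.
  have -> : (k |: S == T) = (S == T :\ k).
    apply/eqP/eqP => [<-|->]; [by rewrite setU1K | by rewrite setD1K].
  by case: eqP => [->|]; [rewrite ext_signD1id | rewrite scale0r !scaler0].
case: eqP => [E|]; last by rewrite scale0r scaler0.
by rewrite -E setU11 in kT.
Qed.

Lemma ext_map_unit (h : {linear mp -> mp}) T (y : mp) :
  ext_map h (tens (ext_basis R T) y) = tens (ext_basis R T) (h y).
Proof. by apply/ffunP=> S; rewrite !ffunE linearZ. Qed.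

Lemma kappa_unit T : kappa (tens (ext_basis R T) 1) =
  \sum_(l in T) ext_sign R false l T *: tens (ext_basis R (T :\ l)) (lmulX R l 1).
Proof.
rewrite /kappa [RHS]big_mkcond /=; apply: eq_bigr => l _.
rewrite contractE ann_unit; case: ifP => _; last exact: (linear0 (ext_map (lmulX R l))).
by rewrite -(ext_map_unit (lmulX R l)) (linearZ_LR (ext_map (lmulX R l))).
Qed.

Lemma tens_sumr (M : lmodType R) I (r : seq I) (P : pred I) (F : I -> M) x :
  tens x (\sum_(i <- r | P i) F i) = \sum_(i <- r | P i) tens x (F i).
Proof.
apply/ffunP=> S; rewrite ffunE !sum_ffunE scaler_sumr.
by apply: eq_bigr => i _; rewrite ffunE.
Qed.

(** Both sides run over the pairs of a k-set T and an l outside T, with terms $x\wedge\Phi_{T\cup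
    l}\otimes n_T\otimes n_l$. Inserting l from the right in $\Phi_T$ and removing it from the left
    of $n_{T\cup l}$ differ by the sign $(-1)^k$. *)
Lemma Kos_Psi k x :
  Kos_Phi A (Psi k x) = (-1) ^+ k *: ext_map (@kappa R g) (Psi k.+1 x).
Proof.
pose F l T : ext f (ext g mp) := tens (wedge x (ext_Phi A (l |: T)))
  (tens (ext_basis R T) (lmulX R l 1)).
transitivity (\sum_l \sum_(T : {set 'I_g} | #|T| == k)
    if l \in T then 0 else ext_sign R true l T *: F l T).
  apply: eq_bigr => l _; rewrite /Psi.
  have := linear_sum (ext_map (n := f) (lext g (@lmulX R g) l)).
  rewrite /lext /= => ->; rewrite wedge_suml; apply: eq_bigr => T _.
  have := ext_map_tens (lext g (@lmulX R g) l); rewrite /lext /= => ->.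
  rewrite (ext_map_unit (lmulX R l)) wedge_tens wedgeA ext_Phi_wedge.
  by case: ifP => _; rewrite ?wedge0r ?tens0l // wedgeZr tensZl.
rewrite /Psi linear_sum scaler_sumr /=.
transitivity (\sum_(T : {set 'I_g} | #|T| == k.+1) \sum_(l in T)
    ((-1) ^+ k * ext_sign R false l T) *: F l (T :\ l)); last first.
  apply: eq_bigr => T _; rewrite ext_map_tens /= kappa_unit tens_sumr scaler_sumr.
  by apply: eq_bigr => l lT; rewrite tensZr scalerA /F setD1K.
rewrite [RHS](exchange_big_dep predT) //=; apply: eq_bigr => l _.
rewrite [RHS](eq_bigl (fun T : {set 'I_g} => (l \in T) && (#|T| == k.+1))) => [|T]; last first.
  by rewrite andbC.
rewrite big_mkcondr sum_set_in [LHS]big_mkcond [RHS]big_mkcond /=.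
apply: eq_bigr => T _; case: ifP => Tk; case: ifP => lT //=.
- by rewrite cardsU1 lT /= add1n eqSS Tk setU1K ?lT // ext_signU1id ext_sign_compl ?lT // (eqP Tk).
- by rewrite cardsU1 lT /= add1n eqSS Tk.
Qed.

End MiddleMaps.

Lemma sign_scale_eq0 (R : comNzRingType) (M : lmodType R) (s : nat) (y : M) :
  (-1) ^+ s *: y = 0 -> y = 0.
Proof. by move/(canRL (signrZK s)); rewrite scaler0. Qed.

Section Composites.
Variables (R : comNzRingType) (f g : nat) (A : 'M[R]_(f, g)).
Notation mp := {mpoly R[g]}.
Implicit Types (u z : ext f (ext g mp)) (x y : ext f R^o) (T : {set 'I_g}).

Lemma tri_const_coef r s q z T : tri r s q z -> #|T|%:Z != s -> ext_map (const_coef T) z = 0.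
Proof.
move=> zt Ts; apply/ffunP=> S; rewrite !ffunE /const_coef; have := zt S.
case: ifP => [_ /(_ T)|_ ->]; last exact: (linear0 (const_coef T)).
by rewrite (negbTE Ts) => ->; rewrite mcoeff0.
Qed.

Lemma ext_map_kappa_sq z : ext_map (@kappa R g) (ext_map (@kappa R g) z) = 0.
Proof. by apply/ffunP=> S; rewrite !ffunE kappa_sq. Qed.

Lemma ext_map_eta_sq z : ext_map (@Defs.eta R g) (ext_map (@Defs.eta R g) z) = 0.
Proof. by apply/ffunP=> S; rewrite !ffunE eta_sq. Qed.

Lemma Kos_kappa_Psi k x : Kos_Phi A (ext_map (@kappa R g) (Psi A k x)) = 0.
Proof.
by rewrite Kos_kappa Kos_Psi linearZ_LR /= ext_map_kappa_sq scaler0.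
Qed.

Lemma wedge_ext_Phi_vect T k :
  wedge (ext_Phi A T) (Phi_basis A k) = (-1) ^+ #|T| *: wedge (Phi_basis A k) (ext_Phi A T).
Proof. by rewrite cardE; exact: wedge_wprod_vect. Qed.

Lemma ext_Phi_mul0 T T' : T :&: T' != set0 -> wedge (ext_Phi A T) (ext_Phi A T') = 0.
Proof.
case/set0Pn=> l; rewrite inE => /andP[lT lT'].
have := ext_Phi_wedge A l (T' :\ l); rewrite setD11 setD1K //.
move/(congr1 (fun w => ext_sign R true l (T' :\ l) *: w)).
rewrite scalerA ext_signsq scale1r => <-.
rewrite wedgeZr wedge_ext_Phi_vect wedgeZr -wedgeA ext_Phi_wedge lT.
by rewrite wedge0l !scaler0.
Qed.

(** Subsets of sizes k and a of a g-element set must meet, and the product of the corresponding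
    minors of columns has a repeated factor. With $k=\mathfrak g+1-a$ this gives
    $d_{i+1}d_{i+2}=0$. *)
Lemma Psi_d_high_mid k (a : nat) r q z : (g < k + a)%N -> tri r a q z ->
  Psi A k (d_high_mid A z) = 0.
Proof.
move=> ka zt; rewrite /Psi big1 // => T /eqP Tk.
rewrite d_high_midE wedge_suml big1 ?tens0l // => T' _.
have [Ta|Ta] := eqVneq #|T'| a; last by rewrite (tri_const_coef zt) ?wedge0l ?eqz_nat.
rewrite wedgeA ext_Phi_mul0 ?wedge0r // -card_gt0.
rewrite -(ltn_add2l #|T' :|: T|) cardsUI Tk Ta addn0 addnC.
by apply: leq_ltn_trans ka; rewrite (leq_trans (max_card _)) ?card_ord.
Qed.

Lemma const_coef_eta (y : ext g mp) T : const_coef T (Defs.eta y) =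
  \sum_(l in T) ext_sign R true l T *: const_coef (T :\ l) (ext_map (ldivX R l) y).
Proof.
rewrite /Defs.eta linear_sum [RHS]big_mkcond; apply: eq_bigr => l _ /=.
rewrite wedge_vect /const_coef ffunE; case: ifP => _; last by rewrite mcoeff0.
by rewrite mcoeffZ.
Qed.

(** The dual of [Kos_Psi]: in degree-one coefficients of u, the column l stands after $\Phi_T$ on
    the left-hand side and before it on the right-hand side, where T has s elements. *)
Lemma d_high_mid_eta (s : nat) r q u : tri r s q u ->
  d_high_mid A (ext_map (@Defs.eta R g) u) = (-1) ^+ s *: d_high_mid A (eta_Phi A u).
Proof.
move=> ut; pose Du l : ext f (ext g mp) := ext_map (lext g (@ldivX R g) l) u.
pose G l T := wedge (ext_map (const_coef T) (Du l)) (wedge (ext_Phi A T) (Phi_basis A l)).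
transitivity (\sum_l \sum_(T : {set 'I_g}) G l T).
  rewrite d_high_midE.
  transitivity (\sum_(T : {set 'I_g}) \sum_(l in T) ext_sign R true l T *:
      wedge (ext_map (const_coef (T :\ l)) (Du l)) (ext_Phi A T)).
    apply: eq_bigr => T _.
    have -> : ext_map (const_coef T) (ext_map (@Defs.eta R g) u) =
        \sum_(l in T) ext_sign R true l T *: ext_map (const_coef (T :\ l)) (Du l).
      apply/ffunP=> S; rewrite !ffunE const_coef_eta sum_ffunE.
      by apply: eq_bigr => l _; rewrite !ffunE.
    by rewrite wedge_suml; apply: eq_bigr => l _; rewrite wedgeZl.
  rewrite (exchange_big_dep predT) //=; apply: eq_bigr => l _.
  rewrite sum_set_in [LHS]big_mkcond; apply: eq_bigr => T _; rewrite /G ext_Phi_wedge.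
  case: ifP => [/negbTE lT|/negbFE lT]; rewrite lT ?wedge0r //.
  by rewrite setU1K ?lT // ext_signU1id wedgeZr.
rewrite d_high_midE scaler_sumr exchange_big; apply: eq_bigr => T _.
have -> : ext_map (const_coef T) (eta_Phi A u) =
    \sum_l wedge (ext_map (const_coef T) (Du l)) (Phi_basis A l).
  by rewrite /eta_Phi linear_sum; apply: eq_bigr => l _ /=; rewrite ext_map_wedge.
rewrite wedge_suml scaler_sumr; apply: eq_bigr => l _ /=; rewrite /G wedgeA.
have [Ts|Ts] := eqVneq #|T| s; first by rewrite wedge_ext_Phi_vect Ts wedgeZr.
suff -> : ext_map (const_coef T) (Du l) = 0 by rewrite !wedge0l scaler0.
apply: (tri_const_coef (r := r) (s := s) (q := q - 1)); rewrite ?eqz_nat //.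
apply: (ext_part_map (h := lext g (@ldivX R g) l)) ut => y.
by apply: ext_part_map => w; exact: degree_part_div_contract.
Qed.

Lemma d_high_mid_eta_Phi (s : nat) r q u : tri r s q u ->
  ext_map (@Defs.eta R g) u = 0 -> d_high_mid A (eta_Phi A u) = 0.
Proof.
move=> ut eu; have := d_high_mid_eta ut; rewrite eu linear0.
by move/esym/sign_scale_eq0.
Qed.

Lemma d_high_mid_tens x T :
  d_high_mid A (tens x (tens (ext_basis R T) 1)) = wedge x (ext_Phi A T).
Proof.
rewrite d_high_midE (bigD1 T) //= big1 ?addr0 => [|T' T0].
  congr wedge; apply/ffunP=> S; rewrite !ffunE /const_coef !ffunE eqxx scale1r.
  by rewrite mcoeffZ mcoeff1 eqxx mulr1.
rewrite (_ : ext_map _ _ = 0) ?wedge0l //; apply/ffunP=> S.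
by rewrite !ffunE /const_coef !ffunE (negbTE T0) scale0r scaler0 mcoeff0.
Qed.

Lemma Psi0 x : Psi A 0 x = tens x (tens (ext_basis R set0) 1).
Proof.
by rewrite /Psi (big_pred1 set0) ?ext_Phi0 ?wedge1r // => T; rewrite /= cards_eq0.
Qed.

Lemma kapB z u : ext_map (@kappa R g) (z - u) =
  ext_map (@kappa R g) z - ext_map (@kappa R g) u.
Proof. exact: linearB. Qed.

Lemma etB z u : ext_map (@Defs.eta R g) (z - u) =
  ext_map (@Defs.eta R g) z - ext_map (@Defs.eta R g) u.
Proof. exact: linearB. Qed.

Lemma kapZ c z : ext_map (@kappa R g) (c *: z) = c *: ext_map (@kappa R g) z.
Proof. exact: linearZ_LR. Qed.

Lemma PsiZ k c x : Psi A k (c *: x) = c *: Psi A k x.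
Proof. exact: linearZ_LR. Qed.

Lemma Kos_Phi0 : Kos_Phi A 0 = 0.
Proof. exact: linear0. Qed.

Lemma eta_Phi0 : eta_Phi A 0 = 0.
Proof. exact: linear0. Qed.

Lemma et0 : ext_map (n := f) (@Defs.eta R g) 0 = 0.
Proof. exact: (linear0 (ext_map (@Defs.eta R g))). Qed.

Lemma kap0 : ext_map (n := f) (@kappa R g) 0 = 0.
Proof. exact: (linear0 (ext_map (@kappa R g))). Qed.

End Composites.

Lemma strict_homo_inj m n (p : 'I_m -> 'I_n) :
  {homo p : u v / (u < v)%N} -> injective p.
Proof.
move=> p_homo k l pkl; apply/val_inj; case: (ltngtP k l) => // /p_homo.
  by rewrite pkl ltnn.
by rewrite pkl ltnn.
Qed.

(** * Exactness for the inclusion of a coordinate subspace *)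

Section SplitMap.
Variables (R : comNzRingType) (f g : nat) (p : 'I_g -> 'I_f).
Hypothesis p_homo : {homo p : u v / (u < v)%N}.
Notation mp := {mpoly R[g]}.
Notation E := (incl_mx R p).
Notation kap := (ext_map (@kappa R g)).
Notation et := (ext_map (@Defs.eta R g)).
Implicit Types (u v w z : ext f (ext g mp)) (x y : ext f R^o) (T : {set 'I_g}).

Let p_inj : injective p := strict_homo_inj p_homo.

Let LX : 'I_g -> {linear ext g mp -> ext g mp} := lext g (@lmulX R g).
Let LD : 'I_g -> {linear ext g mp -> ext g mp} := lext g (@ldivX R g).

Let LDX l (z : ext f (ext g mp)) : lext f LD l (lext f LX l z) = z.
Proof.
by apply/ffunP=> S; apply/ffunP=> T; rewrite /lext /= !ffunE /= div_contract_sym_mul.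
Qed.

Lemma Kos_inclE z : Kos_Phi E z = koszul (lcre (ext g mp) true p) (lext f LX) z.
Proof.
rewrite /Kos_Phi /koszul; apply: eq_bigr => l _.
by rewrite Phi_basis_incl wedge_vect -(ext_map_cre (LX l)).
Qed.

Lemma eta_inclE z : eta_Phi E z = koszul (lcre (ext g mp) true p) (lext f LD) z.
Proof.
rewrite /eta_Phi /koszul; apply: eq_bigr => l _.
by rewrite Phi_basis_incl wedge_vect -(ext_map_cre (LD l)).
Qed.

Lemma tri_LX r s q l z : tri r s q z -> tri r s (q + 1) (lext f LX l z).
Proof.
apply: (ext_part_map (h := LX l)) => y; apply: ext_part_map => c.
exact: degree_part_sym_mul.
Qed.

Lemma tri_LD r s q l z : tri r s q z -> tri r s (q - 1) (lext f LD l z).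
Proof.
apply: (ext_part_map (h := LD l)) => y; apply: ext_part_map => c.
exact: degree_part_div_contract.
Qed.

Let sub_sq s q : submod (@ext_part R g mp s (@degree_part R g q)).
Proof. exact/submod_ext_part/submod_degree_part. Qed.

Lemma tri_div_eq0 r s q z : q != 0 -> tri r s q z ->
  (forall l, lext f LD l z = 0) -> z = 0.
Proof.
move=> q0 zt Dz; apply/ffunP=> S; apply/ffunP=> T; apply/mpolyP=> m.
rewrite !ffunE mcoeff0; have [->|m0] := eqVneq m 0%MM.
  have := zt S; case: ifP => [_ /(_ T)|_ ->]; last by rewrite ffunE mcoeff0.
  case: ifP => [_ /degree_partP zq|_ ->]; last by rewrite mcoeff0.
  by apply/eqP; apply: contraT => /zq; rewrite mdeg0 => q0'; rewrite -q0' in q0.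
apply: div_contract_eq0 => // k; have /ffunP/(_ S)/ffunP/(_ T) := Dz k.
by rewrite !ffunE.
Qed.

(** Contraction by the coordinates [p l] of F gives the homotopy, and [kE] lands in polynomial
    degree 0. That degree is a true exception: the product of all [p l] is a cycle there without
    being a boundary. *)
Lemma Kos_exact r s q z : q != 0 -> tri r s q z -> Kos_Phi E z = 0 ->
  exists2 y : ext f (ext g mp), tri (r - 1) s (q - 1) y & Kos_Phi E y = z.
Proof.
have cliff := clifford_cre (ext g mp) true p_inj.
have comm := commuting_cre true p (shifts_lext g (shifts_sym R g)).
move=> q0 zt; rewrite Kos_inclE => dz.
have [l u ut|l u ut|zH zE] := @kHE_stable _ _ _ (lcre (ext g mp) true p) (lann _ true p)
    (lext f LX) (lext f LD) (enum 'I_g) (tri r s q) (tri (r - 1) s (q - 1))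
    (@submod_tri _ _ _ _ _ _) _ _ z zt.
- by apply: tri_LD; apply: ext_part_ann (sub_sq _ _) _.
- rewrite (kprojE_CB cliff comm _ (LDX l)).
  have uv : tri r s q (lcre (ext g mp) true p l (lann (ext g mp) true p l u)).
    by rewrite -[r](subrK 1); apply: ext_part_cre => //; apply: ext_part_ann.
  by apply: triB => //; rewrite -[q](subrK 1); apply: tri_LX; apply: tri_LD.
eexists; first exact: zH.
rewrite Kos_inclE {2}[z](koszul_cycle cliff comm (enum 'I_g)) //.
by rewrite (tri_div_eq0 q0 zE) ?addr0 // => l; exact: (kE_killed_C cliff comm).
Qed.

Lemma eta_Phi_exact r s q z : q != 0 -> tri r s q z -> eta_Phi E z = 0 ->
  exists2 y : ext f (ext g mp), tri (r - 1) s (q + 1) y & eta_Phi E y = z.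
Proof.
have cliff := clifford_cre (ext g mp) true p_inj.
have comm := commuting_cre true p (shifts_lext g (shifts_div R g)).
move=> q0 zt; rewrite eta_inclE => dz.
have [l u ut|l u ut|zH zE] := @kHE_stable _ _ _ (lcre (ext g mp) true p) (lann _ true p)
    (lext f LD) (lext f LX) (enum 'I_g) (tri r s q) (tri (r - 1) s (q + 1))
    (@submod_tri _ _ _ _ _ _) _ _ z zt.
- by apply: tri_LX; apply: ext_part_ann (sub_sq _ _) _.
- rewrite (kprojE_BC cliff comm _ (LDX l)).
  have uv : tri r s q (lann (ext g mp) true p l (lcre (ext g mp) true p l u)).
    by rewrite -[r](addrK 1); apply: ext_part_ann => //; apply: ext_part_cre.
  by apply: triB => //; rewrite -[q](subrK 1); apply: tri_LX; apply: tri_LD.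
eexists; first exact: zH.
rewrite eta_inclE {2}[z](koszul_cycle cliff comm (enum 'I_g)) //.
by rewrite (tri_div_eq0 q0 zE) ?addr0 // => l; exact: (kE_killed_B cliff comm).
Qed.

End SplitMap.

Section Contractions.
Variables (R : comNzRingType) (f g : nat).
Notation mp := {mpoly R[g]}.
Notation kap := (ext_map (@kappa R g)).
Notation et := (ext_map (@Defs.eta R g)).
Implicit Types (z : ext f (ext g mp)).

Lemma kap_exact r s q z : (s != 0) || (q != 0) -> tri r s q z -> kap z = 0 ->
  exists2 u : ext f (ext g mp), tri r (s + 1) (q - 1) u & kap u = z.
Proof.
have [H HP] := kappa_contraction R g => sq zt kz.
exists (ext_map H z).
  by apply: (ext_part_map (h := H)) zt => y /HP[].
apply/ffunP=> S; rewrite !ffunE; have := zt S; case: ifP => [_ /HP[_ -> //]|_ ->].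
  by have /ffunP/(_ S) := kz; rewrite !ffunE.
by rewrite !linear0.
Qed.

Lemma et_exact r s q z : (s != 0) || (q != 0) -> tri r s q z -> et z = 0 ->
  exists2 u : ext f (ext g mp), tri r (s - 1) (q + 1) u & et u = z.
Proof.
have [H HP] := eta_contraction R g => sq zt kz.
exists (ext_map H z).
  by apply: (ext_part_map (h := H)) zt => y /HP[].
apply/ffunP=> S; rewrite !ffunE; have := zt S; case: ifP => [_ /HP[_ -> //]|_ ->].
  by have /ffunP/(_ S) := kz; rewrite !ffunE.
by rewrite !linear0.
Qed.

(** A preimage under [kappa] would have Sym degree -1. *)
Lemma kap_inj r s z : s != 0 -> tri r s 0 z -> kap z = 0 -> z = 0.
Proof.
move=> s0 zt kz; have [|u ut <-] := kap_exact _ zt kz; first by rewrite s0.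
by rewrite (tri_neg _ ut) ?linear0 // orbT.
Qed.

Lemma et_deg0 r s z : tri r s 0 z -> et z = 0.
Proof. by move/tri_eta/tri_neg; apply; rewrite orbT. Qed.

End Contractions.

Section SplitExact.
Variables (R : comNzRingType) (f g : nat) (p : 'I_g -> 'I_f).
Hypothesis p_homo : {homo p : u v / (u < v)%N}.
Notation mp := {mpoly R[g]}.
Notation E := (incl_mx R p).
Notation kap := (ext_map (@kappa R g)).
Notation et := (ext_map (@Defs.eta R g)).
Implicit Types (u v w z : ext f (ext g mp)) (x y : ext f R^o) (T : {set 'I_g}).

(** A preimage y of z under [Kos_Phi] need not lie in the hook module. The induction hypothesis
    applied to [kappa y], of smaller exterior degree, yields the correction of y by a [Kos_Phi]
    boundary that makes it a cycle of [kappa]. *)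
Lemma low_exact (s : nat) r q z : q != 0 -> q != 1 -> tri r s q z -> kap z = 0 ->
  Kos_Phi E z = 0 ->
  exists y : ext f (ext g mp), [/\ tri (r - 1) s (q - 1) y, kap y = 0 & Kos_Phi E y = z].
Proof.
elim: s r z => [|s IHs] r z q0 q1 zt kz dz;
  have [y yt yz] := Kos_exact p_homo q0 zt dz.
  exists y; split=> //; have := tri_kappa yt; move/tri_neg; apply; by rewrite orbC orbT.
have kyt := tri_kappa yt; rewrite intS [1 + _]addrC addrK subrK in kyt.
have kky : kap (kap y) = 0 by exact: ext_map_kappa_sq.
have dky : Kos_Phi E (kap y) = 0 by rewrite Kos_kappa yz.
have [y1 [y1t ky1 dy1]] := IHs _ _ q0 q1 kyt kky dky.
(* The polynomial degree of y1 is q - 1, nonzero by assumption, which avoids bidegree (0, 0). *)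
have [|y2 y2t ky2] := kap_exact _ y1t ky1; first by rewrite subr_eq0 q1 orbT.
exists (y - Kos_Phi E y2); split.
- apply: triB => //; have := tri_Kos E y2t.
  by rewrite [_%:Z + 1]addrC -intS !subrK.
- by rewrite kapB -Kos_kappa ky2 dy1 subrr.
by rewrite Kos_PhiB Kos_sq subr0.
Qed.

(** In Sym degree 1 the preimage y has degree 0 and cannot be corrected any more. It is determined
    by [kappa y] instead, which identifies it with a value of [Psi]; then [Kos_Psi] rewrites its
    image. *)
Lemma low_mid_exact (s : nat) r z : tri r s 1 z -> kap z = 0 -> Kos_Phi E z = 0 ->
  exists2 x : ext f R^o, ext_part (r - 1 - s%:Z) (fun _ => True) x
    & kap (Psi E s.+1 x) = z.
Proof.
elim: s r z => [|s IHs] r z zt kz dz;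
  have [//|y] := Kos_exact p_homo _ zt dz; rewrite subrr => yt yz.
  have [x xt yx] := tri00_Psi E yt; exists x; first by rewrite subr0.
  by rewrite -yz yx Kos_Psi expr0 scale1r.
have kyt := tri_kappa yt; rewrite intS [1 + _]addrC addrK add0r in kyt.
have kky : kap (kap y) = 0 by exact: ext_map_kappa_sq.
have dky : Kos_Phi E (kap y) = 0 by rewrite Kos_kappa yz.
have [x xt kx] := IHs _ _ kyt kky dky.
have xt' : ext_part (r - 1 - s.+1%:Z) (fun _ : R^o => True) x.
  by rewrite intS opprD addrA.
have yx : y = Psi E s.+1 x.
  apply/eqP; rewrite -subr_eq0; apply/eqP.
  apply: (@kap_inj _ _ _ (r - 1) s.+1) => //; last by rewrite kapB kx subrr.
  by apply: triB => //; have := tri_Psi E s.+1 xt'; rewrite subrK.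
exists ((-1) ^+ s.+1 *: x).
  by case: (submod_ext_part f (r - 1 - s.+1%:Z) (@submodT R R^o)) => _ _; apply.
by rewrite PsiZ kapZ -Kos_Psi -yx yz.
Qed.

(** The chase starts with a preimage u under [eta]. The induction hypothesis replaces [eta_Phi u] by
    the image of a cycle v of [eta]; then u - v is the image under [eta_Phi] of some w, and [eta w]
    is the required element. *)
Lemma high_exact (a : nat) r q z : 0 <= q -> tri r a q z -> et z = 0 ->
  (if q == 0 then d_high_mid E z = 0 else eta_Phi E z = 0) ->
  exists y : ext f (ext g mp), [/\ tri (r - 1) a (q + 1) y, et y = 0 & eta_Phi E y = z].
Proof.
elim: a r q z => [|a IHa] r q z q_ge0 zt ez dz.
  suff -> : z = 0 by exists 0; rewrite et0 eta_Phi0; split=> //; exact: tri0.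
  case: eqP dz zt => [->|/eqP q0] dz zt.
    have [x _ zx] := tri00_Psi E zt; move: dz; rewrite zx Psi0 d_high_mid_tens.
    by rewrite ext_Phi0 wedge1r => ->; rewrite tens0l.
  have [|u ut <-] := et_exact _ zt ez; first by rewrite q0 orbT.
  by rewrite (tri_neg _ ut) ?linear0.
have [//|u] := et_exact _ zt ez; rewrite intS [1 + _]addrC addrK => ut uz.
have dut := tri_eta_Phi E ut; rewrite addrK in dut.
have edu : et (eta_Phi E u) = 0.
  have [q0|q0] := eqVneq q 0; first by rewrite q0 in dut; exact: et_deg0 dut.
  by rewrite (negbTE q0) in dz; rewrite -eta_Phi_eta uz.
have [|v [vt ev dv]] := IHa _ _ _ q_ge0 dut edu.
  case: eqP dz => q0 dz; last exact: eta_Phi_sq.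
  (* For q = 0 the cycle condition passes from z to [eta_Phi u] through the middle term. *)
  have := d_high_mid_eta E ut; rewrite uz dz => /esym.
  exact: sign_scale_eq0.
rewrite addrK in vt.
have [||w wt dw] := eta_Phi_exact p_homo _ (triB ut vt).
- by rewrite gt_eqF // ltr_wpDl.
- by rewrite eta_PhiB dv subrr.
exists (et w); split; last by rewrite eta_Phi_eta dw etB ev subr0.
  by have := tri_eta wt; rewrite [a%:Z + 1]addrC -intS addrK.
exact: ext_map_eta_sq.
Qed.

End SplitExact.

Lemma exists_subset_card (T : finType) (P : {set T}) k : (k <= #|P|)%N ->
  exists2 U : {set T}, U \subset P & #|U| = k.
Proof.
move=> kP; exists [set t in take k (enum P)].
  by apply/subsetP=> t; rewrite inE => /mem_take; rewrite mem_enum.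
rewrite cardsE (card_uniqP _) ?take_uniq ?enum_uniq //.
by rewrite size_takel // -cardE.
Qed.

(** The only subset of S :|: B with complement B is S, so multiplication by $v_B$ does not lose the
    coefficient at S. *)
Lemma wedge_disjoint (R : comNzRingType) n (M : lmodType R) (x : ext n M)
    (S B : {set 'I_n}) : [disjoint S & B] ->
  wedge x (ext_basis R B) (S :|: B) = (-1) ^+ inversions S B *: x S.
Proof.
move=> dSB; rewrite ffunE (bigD1 S) ?inE ?subsetUl //= big1 ?addr0 => [|A].
  have -> : (S :|: B) :\: S = B.
    by rewrite setDUl setDv set0U; apply/setDidPl; rewrite disjoint_sym.
  by rewrite ffunE eqxx mulr1.
rewrite inE ffunE => /andP[sA nA]; case: eqP => [AB|]; last by rewrite mulr0 scale0r.
case/eqP: nA; apply/setP=> t; have /setP/(_ t) := AB; rewrite !inE.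
have := subsetP sA t; rewrite inE.
have /pred0P/(_ t) /= := dSB.
case: (t \in S) => /= [-> _|_]; first by rewrite andbT => /negbFE.
by case: (t \in A) => // /(_ isT) ->.
Qed.

Section SplitMid.
Variables (R : comNzRingType) (f g : nat) (p : 'I_g -> 'I_f).
Hypothesis p_homo : {homo p : u v / (u < v)%N}.
Notation mp := {mpoly R[g]}.
Notation E := (incl_mx R p).

Lemma mid_exact (k a : nat) t (x : ext f R^o) : (k + a = g.+1)%N -> (0 < k)%N ->
  ext_part t (fun _ => True) x -> ext_map (@kappa R g) (Psi E k x) = 0 ->
  exists2 w : ext f (ext g mp), tri (t - a%:Z) a 0 w & d_high_mid E w = x.
Proof.
move=> kag k0 xt kx.
have Px : Psi E k x = 0.
  apply: (@kap_inj _ _ _ (t + k%:Z) k) => //; last exact: tri_Psi.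
  by rewrite eqz_nat -lt0n.
have {kx}xT (T : {set 'I_g}) : #|T| = k -> wedge x (ext_basis R (p @: T)) = 0.
  by move=> Tk; have := Psi_wedge Tk Px; rewrite ext_Phi_incl.
suff wS (S : {set 'I_f}) : exists w : ext f (ext g mp),
    tri (t - a%:Z) a 0 w /\ d_high_mid E w = x S *: ext_basis R S.
  have [w wP] := fin_all_exists wS; exists (\sum_S w S).
    by apply: submod_sum => [|S _]; [exact: submod_tri | case: (wP S)].
  rewrite [RHS]ext_basis_sum linear_sum; apply: eq_bigr => S _.
  by case: (wP S).
(* If at least [a] of the [p l] lie in S, then [ext_basis R S] is a multiple of
   [ext_Phi E T] for some T with [#|T| = a]. Otherwise [p @: T] misses S for some T
   with [#|T| = k], so that [xT] gives [x S = 0]. *)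
pose P := [set l | p l \in S].
have w0 : x S = 0 -> exists w : ext f (ext g mp),
    tri (t - a%:Z) a 0 w /\ d_high_mid E w = x S *: ext_basis R S.
  by move->; exists 0; rewrite scale0r linear0; split=> //; exact: tri0.
have := xt S; case: (#|S|%:Z =P t) => [St _|_ /w0 //].
have [aP|aP] := leqP a #|P|.
  have [T TP Ta] := exists_subset_card aP.
  have pTS : p @: T \subset S.
    by apply/subsetP=> _ /imsetP[l /(subsetP TP) + ->]; rewrite inE.
  (* Taking [p @: T] out of S and multiplying it back restores S up to a reordering sign, which the
     coefficient cancels. *)
  exists (((-1) ^+ inversions (S :\: p @: T) (p @: T) * x S) *:
    tens (ext_basis R (S :\: p @: T)) (tens (ext_basis R T) 1)); split.
    case: (submod_tri R f g (t - a%:Z) a 0) => _ _; apply.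
    rewrite -Ta; apply: tri_tens; last by apply: unit_part; exact: degree_part1.
    have -> : t - #|T|%:Z = #|S :\: p @: T|%:Z.
      rewrite cardsD (setIidPr pTS) card_imset; last exact: strict_homo_inj.
      have := subset_leq_card pTS; rewrite card_imset; last exact: strict_homo_inj.
      by move=> le; rewrite -St subzn.
    exact: ext_part_basis.
  rewrite linearZ_LR /= d_high_mid_tens ext_Phi_incl // wedge_basis.
  have -> : [disjoint S :\: p @: T & p @: T].
    by rewrite -setI_eq0; apply/eqP/setP=> l; rewrite !inE; case: (l \in p @: T); rewrite ?andbF.
  rewrite scalerA mulrAC -expr2 sqrr_sign mul1r; congr (_ *: ext_basis R _).
  by rewrite setUC -{2}(setID S (p @: T)) (setIidPr pTS).
have [|T TP Tk] := @exists_subset_card _ (~: P) k.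
  by rewrite cardsCs setCK card_ord; lia.
apply: w0; have dS : [disjoint S & p @: T].
  rewrite disjoint_sym disjoints_subset; apply/subsetP=> _ /imsetP[l /(subsetP TP) + ->].
  by rewrite !inE.
have := wedge_disjoint x dS; rewrite xT // ffunE => /esym.
exact: sign_scale_eq0.
Qed.

End SplitMid.

(** * Regular sequences and nilpotent homology *)

Section IdealMultiples.
Variable R : comNzRingType.

(** The submodule $tC$, with multipliers in C itself rather than in V. Recursion on the list exposes
    the last element of the sequence, the one peeled off in the inductions below. *)
Fixpoint mulI (V : lmodType R) (C : V -> Prop) (t : seq R) (z : V) : Prop :=
  if t is x :: t' then exists c z', [/\ C c, mulI C t' z' & z = x *: c + z'] else z = 0.

(* t lists the sequence in reverse order: its head is the last element. *)
Fixpoint wreg (V : lmodType R) (C : V -> Prop) (t : seq R) : Prop :=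
  if t is x :: t' then
    wreg C t' /\ forall y, C y -> mulI C t' (x *: y) -> mulI C t' y
  else True.

Lemma submod_mulI (V : lmodType R) (C : V -> Prop) t : submod C -> submod (mulI C t).
Proof.
move=> Csub; have [C0 CD CZ] := Csub; elim: t => [|x t [I0 ID IZ]] /=.
  by split=> [//|x y -> ->|c x ->]; rewrite ?addr0 ?scaler0.
split=> [|y z [c [y' [Cc Iy ->]]] [e [z' [Ce Iz ->]]]|a y [c [y' [Cc Iy ->]]]].
- by exists 0, 0; rewrite scaler0 addr0.
- exists (c + e), (y' + z'); split; [exact: CD | exact: ID |].
  by rewrite addrACA scalerDr.
exists (a *: c), (a *: y'); split; [exact: CZ | exact: IZ |].
by rewrite scalerDr !scalerA mulrC.
Qed.

Lemma mulI_map (V W : lmodType R) (C : V -> Prop) (C' : W -> Prop) (h : V -> W) t z :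
  linear h -> (forall c, C c -> C' (h c)) -> mulI C t z -> mulI C' t (h z).
Proof.
move=> h_lin hC; have hD x c y : h (x *: c + y) = x *: h c + h y by apply: h_lin.
elim: t z => [|x t IHt] z /=.
  by move=> ->; have := hD (-1) 0 0; rewrite !scaleN1r oppr0 addr0 addNr.
by case=> c [z' [Cc Iz' ->]]; exists (h c), (h z'); split; [exact: hC | exact: IHt |].
Qed.

Lemma mulI_mem (V : lmodType R) (C : V -> Prop) t x c :
  submod C -> x \in t -> C c -> mulI C t (x *: c).
Proof.
move=> Csub; have [C0 CD CZ] := Csub; elim: t => [//|y t IHt] /=.
rewrite inE => /orP[/eqP-> Cc|xt Cc].
  by exists c, 0; rewrite addr0; split=> //; case: (submod_mulI t Csub).
by exists 0, (x *: c); rewrite scaler0 add0r; split=> //; exact: IHt.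
Qed.

Lemma submodB (V : lmodType R) (C : V -> Prop) x y : submod C -> C x -> C y -> C (x - y).
Proof. by case=> _ CD CZ Cx Cy; rewrite -scaleN1r; apply/CD/CZ. Qed.

Lemma wreg_catrev (V : lmodType R) (C : V -> Prop) u t : wreg C (catrev u t) -> wreg C t.
Proof. by elim: u t => [|x u IHu] t // /IHu[]. Qed.

End IdealMultiples.

Section Depth.
Variables (R : comNzRingType) (M : int -> lmodType R) (C : forall j, M j -> Prop).
Variables (d : forall j k, M j -> M k) (N : int) (X : R -> Prop).
Hypotheses (Csub : forall j, submod (@C j)) (d_lin : forall j k, linear (@d j k)).
Hypothesis dC : forall j k, j = k + 1 -> forall z, C z -> C (d k (z : M j)).
Hypothesis dd : forall j k l, j = k + 1 -> k = l + 1 ->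
  forall z : M j, C z -> d l (d k z) = 0.
Hypothesis CN : forall j (z : M j), N < j -> C z -> z = 0.
Hypothesis nilp : forall x, X x -> forall j k l, j = k + 1 -> k = l + 1 ->
  forall z : M k, C z -> d l z = 0 ->
  exists n, exists2 b : M j, C b & d k b = x ^+ n *: z.

Definition bounds j k t (z : M k) : Prop :=
  exists (b : M j) (c : M k), [/\ C b, mulI (@C k) t c & z = d k b + c].

Let dD j k x (y z : M j) : d k (x *: y + z) = x *: d k y + d k z.
Proof. exact: d_lin. Qed.

Let d0 j k : d k (0 : M j) = 0.
Proof. by have := dD k (-1) (0 : M j) 0; rewrite !scaleN1r oppr0 addr0 addNr. Qed.

Let dZ j k x (z : M j) : d k (x *: z) = x *: d k z.
Proof. by rewrite -[x *: z]addr0 dD d0 addr0. Qed.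

Let dB j k (y z : M j) : d k (y - z) = d k y - d k z.
Proof. by rewrite addrC -scaleN1r dD scaleN1r addrC. Qed.

Let dI j k t (z : M j) : j = k + 1 -> mulI (@C j) t z -> mulI (@C k) t (d k z).
Proof. by move=> jk; apply: mulI_map => // c; exact: dC. Qed.

Let ID j t (y z : M j) : mulI (@C j) t y -> mulI (@C j) t z -> mulI (@C j) t (y + z).
Proof. by case: (submod_mulI t (Csub j)) => _ D _; apply: D. Qed.

Let IZ j t x (z : M j) : mulI (@C j) t z -> mulI (@C j) t (x *: z).
Proof. by case: (submod_mulI t (Csub j)) => _ _ Z; apply: Z. Qed.

Let CB j (y z : M j) : C y -> C z -> C (y - z).
Proof. exact: submodB. Qed.

Let CZ j x (z : M j) : C z -> C (x *: z).
Proof. by case: (Csub j) => _ _ Z; apply: Z. Qed.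

(** The long exact sequence of multiplication by x, made explicit. The connecting map sends z to c;
    once a power of y has made c a boundary modulo t, subtracting a multiple of x turns that
    multiple of z into a cycle modulo t. *)
Lemma nilpotent_mod t y : X y -> (forall l, wreg (@C l) t) ->
  forall j k l, j = k + 1 -> k = l + 1 -> forall z : M k, C z ->
  mulI (@C l) t (d l z) -> exists n, bounds j t (y ^+ n *: z).
Proof.
move=> Xy; elim: t => [|x t IHt] t_reg j k l jk kl z Cz /=.
  move=> dz; have [n [b Cb db]] := nilp Xy jk kl Cz dz.
  by exists n, b, 0; rewrite addr0.
have tr l' : wreg (@C l') t by case: (t_reg l').
case=> c [s [Cc Is dz]]; pose m := l - 1.
have lm : l = m + 1 by rewrite subrK.
have dc : mulI (@C m) t (d m c).
  have [_] := t_reg m; apply; first exact: dC.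
  have := dd kl lm Cz; rewrite dz dD => /eqP; rewrite addr_eq0 => /eqP ->.
  by rewrite -scaleN1r; apply/IZ/dI.
have [n [b [s' [Cb Is' cE]]]] := IHt tr _ _ _ kl lm c Cc dc.
have [||n' [b' [s2 [Cb' Is2 zE]]]] := IHt tr _ _ _ jk kl (y ^+ n *: z - x *: b).
- by apply: CB; apply: CZ.
- rewrite dB !dZ dz scalerDr scalerA mulrC -scalerA cE scalerDr addrC addrA.
  by rewrite addKr; apply: ID; apply: IZ.
exists (n' + n)%N, b', (x *: (y ^+ n' *: b) + s2); split=> //.
  by exists (y ^+ n' *: b), s2; split=> //; exact: CZ.
rewrite exprD -scalerA -[y ^+ n *: z](subrK (x *: b)) scalerDr zE addrAC -addrA.
by rewrite !scalerA mulrC addrA.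
Qed.

(** The list t holds, in reverse order, the elements already factored out, and u those still to
    come. *)
Lemma acyclic_mod u t : (forall x, x \in u -> X x) -> (forall l, wreg (@C l) (catrev u t)) ->
  forall j k l, j = k + 1 -> k = l + 1 -> N - (size u)%:Z < k ->
  forall z : M k, C z -> mulI (@C l) t (d l z) -> bounds j t z.
Proof.
elim: u t => [|x u IHu] t uX t_reg j k l jk kl Nk z Cz dz.
  rewrite subr0 in Nk; exists 0, 0; split; first by case: (Csub j).
    by case: (submod_mulI t (Csub k)).
  by rewrite d0 addr0; exact: CN Cz.
have t_reg' l' : wreg (@C l') (x :: t) by apply: (wreg_catrev (u := u)); exact: t_reg.
have step (y : M k) : C y -> mulI (@C l) t (d l y) -> bounds j t (x *: y) -> bounds j t y.
  move=> Cy dy [b [s [Cb Is xyE]]].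
  (* Since [d b] equals x y modulo t, b is a cycle modulo x :: t one position higher, where the
     induction hypothesis applies. *)
  have [|||b' [_ [Cb' [c [s2 [Cc Is2 ->]]] bE]]] :=
    IHu (x :: t) _ t_reg (j + 1) j k erefl jk _ b Cb.
  - by move=> x' x'u; apply: uX; rewrite inE x'u orbT.
  - by move: Nk => /=; rewrite jk; lia.
  - exists y, (- s); split=> //; last by rewrite xyE addrK.
    by rewrite -scaleN1r; apply: IZ.
  exists c, (y - d k c); split=> //; last by rewrite addrC subrK.
  have [_] := t_reg' k; apply; first by apply: CB => //; apply: dC.
  have dbE : d k b = x *: d k c + d k s2.
    by rewrite bE -[d j b']scale1r dD scale1r (dd erefl jk) // add0r dD.
  by rewrite scalerBr xyE dbE addrC addrA addKr; apply: ID => //; apply: dI.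
have [|n nB] := nilpotent_mod (uX x _) (fun l' => (t_reg' l').1) jk kl Cz dz.
  by rewrite inE eqxx.
(* Some power of x kills the class of z modulo t; its factors are removed one at a time. *)
elim: n nB => [|n IHn]; first by rewrite scale1r.
rewrite exprS -scalerA => /step nB; apply: IHn; apply: nB; first exact: CZ.
by rewrite dZ; apply: IZ.
Qed.

End Depth.

(** * Regularity on direct summands of free modules *)

Section Regularity.
Variable R : comNzRingType.

Definition whole (V : lmodType R) (_ : V) : Prop := True.

Definition regular_module (V : lmodType R) : Prop :=
  forall t, wreg (@whole R^o) t -> wreg (@whole V) t.

Lemma mulI_extP n (V : lmodType R) t (z : ext n V) :
  mulI (@whole _) t z <-> forall S, mulI (@whole V) t (z S).
Proof.
split=> [Iz S|Iz].
  by apply: (mulI_map (h := fun z : ext n V => z S)) Iz => // c x y; rewrite !ffunE.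
rewrite [z]ext_tens_sum; apply: submod_sum => [|S _]; first exact: submod_mulI.
by apply: mulI_map (Iz S) => // c x y; rewrite tensDr tensZr.
Qed.

Lemma regular_ext n (V : lmodType R) : regular_module V -> regular_module (ext n V).
Proof.
move=> Vreg; elim=> [//|x t IHt] xt_reg; have [t_reg _] := xt_reg; split; first exact: IHt.
move=> y _ /mulI_extP Ixy; apply/mulI_extP => S; have [_] := Vreg _ xt_reg; apply=> //.
by have := Ixy S; rewrite ffunE.
Qed.

Lemma regular_mpoly n : regular_module {mpoly R[n]}.
Proof.
have mulI_mpoly t (z : {mpoly R[n]}) :
    mulI (@whole _) t z <-> forall m, mulI (@whole R^o) t z@_m.
  split=> [Iz m|Iz].
    apply: (mulI_map (W := R^o) (h := mcoeff m)) Iz => // c x y.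
    by rewrite mcoeffD mcoeffZ.
  rewrite [z]mpolyE; apply: submod_sum => [|m _]; first exact: submod_mulI.
  apply: (mulI_map (V := R^o) (h := fun c => c *: 'X_[m])) (Iz m) => // c x y.
  by rewrite scalerDl -scalerA.
elim=> [//|x t IHt] xt_reg; have [t_reg xR] := xt_reg; split; first exact: IHt.
move=> y _ /mulI_mpoly Ixy; apply/mulI_mpoly => m; apply: xR => //.
by have := Ixy m; rewrite mcoeffZ.
Qed.

(** C is a direct summand of V. An element of C that lies in $tV$ then lies in $tC$, by projection,
    so weak regularity descends from V to C. *)
Definition retract (V : lmodType R) (C : V -> Prop) : Prop :=
  exists h : V -> V, [/\ linear h, forall x, C (h x) & forall x, C x -> h x = x].

Lemma wreg_retract (V : lmodType R) (C : V -> Prop) t :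
  regular_module V -> retract C -> wreg (@whole R^o) t -> wreg C t.
Proof.
move=> Vreg [h [h_lin hC hid]]; elim: t => [//|x t IHt] xt_reg.
have [t_reg _] := xt_reg; split=> [|y Cy Ixy]; first exact: IHt.
rewrite -(hid y Cy); apply: (mulI_map (C := @whole V)) => //.
have [_] := Vreg _ xt_reg; apply=> //.
exact: (mulI_map (h := id) (C := C)).
Qed.

Lemma retract_whole (V : lmodType R) : retract (@whole V).
Proof. by exists id. Qed.

Lemma retract_degree_part n q : retract (@degree_part R n q).
Proof.
case: q => q; last first.
  by exists (fun _ => 0); split=> // c x y; rewrite scaler0 addr0.
exists (pihomog mdeg q); split=> [|x|x]; first exact: pihomog_is_linear.
  exact: pihomogP.
exact: pihomog_dE.
Qed.

Lemma retract_ext_part n (V : lmodType R) p (C : V -> Prop) :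
  retract C -> retract (@ext_part R n V p C).
Proof.
case=> h [h_lin hC hid].
exists (fun x : ext n V => [ffun S : {set 'I_n} => if #|S|%:Z == p then h (x S) else 0]); split.
- move=> c x y; apply/ffunP=> S; rewrite !ffunE; case: ifP => _; first exact: h_lin.
  by rewrite scaler0 addr0.
- by move=> x S; rewrite ffunE; case: (_ == p).
move=> x xC; apply/ffunP=> S; rewrite ffunE; have := xC S.
by case: ifP => _; [exact: hid | move->].
Qed.

(** The composite [kappa] after H takes values in the cycles and is the identity on them. *)
Lemma retract_hookL n p q : (p != 0) || (q != 0) -> retract (@hookL R n p q).
Proof.
move=> pq; have [h [h_lin hC hid]] :=
  retract_ext_part n p (retract_degree_part n q).
have [H HP] := kappa_contraction R n.
exists (fun x => kappa (H (h x))); split.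
- by move=> c x y; rewrite h_lin !linearP.
- move=> x; split; last exact: kappa_sq.
  have [Hx _] := HP _ _ _ (hC x).
  by have := kappa_part Hx; rewrite addrK subrK.
by move=> x [xpq kx]; rewrite hid //; have [_ ->] := HP _ _ _ xpq.
Qed.

Lemma retract_hookK n p q : (p != 0) || (q != 0) -> retract (@hookK R n p q).
Proof.
move=> pq; have [h [h_lin hC hid]] :=
  retract_ext_part n p (retract_degree_part n q).
have [H HP] := eta_contraction R n.
exists (fun x => Defs.eta (H (h x))); split.
- by move=> c x y; rewrite h_lin !linearP.
- move=> x; split; last exact: eta_sq.
  have [Hx _] := HP _ _ _ (hC x).
  by have := eta_part Hx; rewrite subrK addrK.
by move=> x [xpq kx]; rewrite hid //; have [_ ->] := HP _ _ _ xpq.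
Qed.

Lemma mulI_seq_ideal t (y : R^o) : mulI (@whole _) t y <-> seq_ideal t y.
Proof.
split.
  elim: t y => [y ->|x t IHt y [c [z [_ /IHt[cs csP ->] ->]]]] /=.
    by exists [::]; rewrite ?big_nil.
  exists ((c : R, x) :: cs) => [q|]; last by rewrite big_cons /=; congr (_ + _); exact: mulrC.
  by rewrite !inE => /orP[/eqP->|/csP ->]; rewrite ?eqxx ?orbT.
case=> cs csP ->; rewrite big_seq; apply: (@submod_sum R R^o (mulI (@whole R^o) t)) => [|q /csP qt].
  exact: submod_mulI.
by rewrite mulrC; exact: (mulI_mem (V := R^o) (C := @whole _)).
Qed.

Lemma regular_seq_wreg s : regular_seq s -> wreg (@whole R^o) (rev s).
Proof.
case=> s_reg _; suff take_reg k : (k <= size s)%N -> wreg (@whole R^o) (rev (take k s)).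
  by rewrite -[s in rev s]take_size; exact: take_reg.
elim: k => [|k IHk] ks; first by rewrite take0.
rewrite (take_nth 0) // rev_rcons; split; first exact/IHk/ltnW.
have idE y : seq_ideal (rev (take k s)) y <-> seq_ideal (take k s) y.
  by split=> -[cs csP ->]; exists cs => // q /csP; rewrite mem_rev.
move=> y _ /mulI_seq_ideal/idE Iy; apply/mulI_seq_ideal/idE.
exact: s_reg Iy.
Qed.

(** Every term of the binomial expansion contains $x^n$ or $y^m$. This carries nilpotency from the
    minors to the ideal that they generate. *)
Lemma radical_submodD (V : lmodType R) (B : V -> Prop) x y z n m : submod B ->
  B (x ^+ n *: z) -> B (y ^+ m *: z) -> B ((x + y) ^+ (n + m) *: z).
Proof.
move=> Bsub; have [_ _ BZ] := Bsub => Bx By.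
rewrite exprDn scaler_suml; apply: submod_sum => // i _.
rewrite -mulr_natr mulrC -scalerA; apply: (BZ).
have [mi|im] := leqP m i.
  by rewrite -(subnK mi) exprD mulrA -scalerA; apply: (BZ).
rewrite mulrC -scalerA; apply: (BZ).
rewrite (_ : (n + m - i = (m - i) + n)%N); last by lia.
by rewrite exprD -scalerA; apply: (BZ).
Qed.

End Regularity.

(** * Assembling the proof *)

Section Minors.
Variables (R : comNzRingType) (f g : nat) (A : 'M[R]_(f, g)).

(** A maximal minor uses all columns in their order, so only its choice of rows matters. *)
Lemma strict_homo_id (q : 'I_g -> 'I_g) : {homo q : u v / (u < v)%N} -> q =1 id.
Proof.
move=> q_homo.
have ge n : forall u : 'I_g, u = n :> nat -> (u <= q u)%N.
  elim: n => [|n IHn] u un; first by rewrite un.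
  have n_g : (n < g)%N by apply: leq_trans (ltn_ord u); rewrite un.
  have := q_homo (Ordinal n_g) u; rewrite un => /(_ (leqnn _)).
  by apply: leq_ltn_trans; apply: (IHn (Ordinal n_g)).
have le n : forall u : 'I_g, (g - u.+1 = n)%N -> (q u <= u)%N.
  elim: n => [|n IHn] u un; first by have := ltn_ord (q u); lia.
  have u_g : (u.+1 < g)%N by lia.
  have := q_homo u (Ordinal u_g) (leqnn _).
  have := IHn (Ordinal u_g); rewrite /= => /(_ _) ; lia.
by move=> u; apply/val_inj/eqP; rewrite eqn_leq (le _ u erefl) (ge _ u erefl).
Qed.

Lemma split_by_minor x : is_minor g A x ->
  exists p : 'I_g -> 'I_f, {homo p : u v / (u < v)%N} /\
  exists Q P : 'M[R]_f, [/\ Q *m incl_mx R p = A, P *m A = x *: incl_mx R p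
    & Q *m P = x%:M].
Proof.
case=> p [q [p_homo /strict_homo_id qid ->]]; exists p; split=> //.
set B := mxsub p q A; set D := \det B; set E := incl_mx R p.
have EB n (X : 'M[R]_(f, n)) : E^T *m X = rowsub p X.
  apply/matrixP=> k l; rewrite !mxE (bigD1 (p k)) //= big1 => [|j jp].
    by rewrite !mxE eqxx mul1r addr0.
  by rewrite !mxE (negbTE jp) mul0r.
have EA : E^T *m A = B by rewrite EB; apply/matrixP=> k l; rewrite !mxE qid.
have EE : E^T *m E = 1%:M.
  rewrite EB; apply/matrixP=> k l; rewrite !mxE.
  by rewrite (inj_eq (strict_homo_inj p_homo)).
pose K := 1%:M - E *m E^T.
have KE : K *m E = 0 by rewrite mulmxBl mul1mx -mulmxA EE mulmx1 subrr.
have EK : E^T *m K = 0 by rewrite mulmxBr mulmx1 mulmxA EE mul1mx subrr.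
have KK : K *m K = K by rewrite {2}/K mulmxBr mulmx1 mulmxA KE mul0mx subr0.
pose S := D%:M - A *m \adj B *m E^T.
(* With the selected rows first, A has blocks B over C. Then Q has the block rows (B, 0), (C, 1),
   and P is its adjugate, with the block rows (adj B, 0), (- C adj B, D). *)
exists (A *m E^T + K), (E *m \adj B *m E^T + K *m S); split.
- by rewrite mulmxDl -mulmxA EE mulmx1 KE addr0.
- have SA : S *m A = 0.
    by rewrite /S mulmxBl mul_scalar_mx -!mulmxA EA mul_adj_mx mul_mx_scalar subrr.
  by rewrite mulmxDl -(mulmxA K) SA mulmx0 addr0 -!mulmxA EA mul_adj_mx mul_mx_scalar.
rewrite mulmxDl (mulmxDr (A *m E^T)) (mulmxDr K _ (K *m S)).
have -> : A *m E^T *m (E *m \adj B *m E^T) = A *m \adj B *m E^T.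
  by rewrite !mulmxA -(mulmxA A) EE mulmx1.
have -> : A *m E^T *m (K *m S) = 0 by rewrite mulmxA -(mulmxA A) EK mulmx0 mul0mx.
have -> : K *m (E *m \adj B *m E^T) = 0 by rewrite !mulmxA KE !mul0mx.
rewrite mulmxA KK addr0 add0r {1}/K mulmxBl mul1mx.
have -> : E *m E^T *m S = 0.
  rewrite -mulmxA mulmxBr !mulmxA EA mul_mx_adj mul_scalar_mx.
  by rewrite mul_mx_scalar subrr mulmx0.
by rewrite subr0 addrC subrK.
Qed.

End Minors.

Section Naturality.
Variables (R : comNzRingType) (f g : nat).
Notation amb := (ambient R f g).

Definition zone_lin (Q : 'M[R]_f) (s : zone) : amb s -> amb s :=
  match s return amb s -> amb s with
  | mid => @ext_lin R f f Q R^o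
  | low | high => @ext_lin R f f Q (ext g {mpoly R[g]})
  end.

(** Agrees with [hook_term] by conversion at [zone_of i j]. The free zone allows case analysis. *)
Definition zone_term (i a j : int) (s : zone) : amb s -> Prop :=
  match s as s return amb s -> Prop with
  | low => ext_part (f%:Z - j) (@hookL R g (g%:Z - a) (i + 1 - j))
  | mid => ext_part (f%:Z - g%:Z + a - i - 1) (fun _ : R^o => True)
  | high => ext_part (f%:Z - g%:Z + 1 - j) (@hookK R g a (j - i - 2))
  end.

Lemma Kos_natural (Q : 'M[R]_f) (A : 'M[R]_(f, g)) z :
  Kos_Phi (Q *m A) (ext_lin Q z) = ext_lin Q (Kos_Phi A z).
Proof.
rewrite /Kos_Phi linear_sum; apply: eq_bigr => l _ /=.
by rewrite ext_lin_wedge (ext_lin_map Q (lext g (@lmulX R g) l)).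
Qed.

Lemma eta_natural (Q : 'M[R]_f) (A : 'M[R]_(f, g)) z :
  eta_Phi (Q *m A) (ext_lin Q z) = ext_lin Q (eta_Phi A z).
Proof.
rewrite /eta_Phi linear_sum; apply: eq_bigr => l _ /=.
by rewrite ext_lin_wedge (ext_lin_map Q (lext g (@ldivX R g) l)).
Qed.

Lemma d_mid_low_natural (Q : 'M[R]_f) (A : 'M[R]_(f, g)) a x :
  d_mid_low (Q *m A) a (ext_lin Q x) = ext_lin Q (d_mid_low A a x).
Proof.
rewrite /d_mid_low linear_sum; apply: eq_bigr => T _ /=.
by rewrite ext_lin_tens ext_lin_wedge_Phi.
Qed.

Lemma d_high_mid_natural (Q : 'M[R]_f) (A : 'M[R]_(f, g)) z :
  d_high_mid (Q *m A) (ext_lin Q z) = ext_lin Q (d_high_mid A z).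
Proof.
rewrite !d_high_midE linear_sum; apply: eq_bigr => T _ /=.
by rewrite ext_lin_wedge_Phi ext_lin_map.
Qed.

Lemma d_mid_low_is_linear (A : 'M[R]_(f, g)) a : linear (@d_mid_low R f g A a).
Proof.
move=> c x y; rewrite /d_mid_low scaler_sumr -big_split; apply: eq_bigr => T _ /=.
rewrite wedgeDl wedgeZl; apply/ffunP=> S; rewrite !ffunE.
by rewrite scalerDl scalerA.
Qed.

Lemma zone_diff_is_linear (A : 'M[R]_(f, g)) a s t : linear (@zone_diff R f g A a s t).
Proof.
case: s; case: t => c x y; rewrite /zone_diff ?scaler0 ?addr0 //.
- exact: Kos_is_linear.
- exact: d_mid_low_is_linear.
- exact: d_high_mid_is_linear.
exact: eta_Phi_is_linear.
Qed.

HB.instance Definition _ (A : 'M[R]_(f, g)) a s t := GRing.isLinear.Build R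
  (amb s) (amb t) _ (@zone_diff R f g A a s t) (@zone_diff_is_linear A a s t).

Lemma zone_lin_is_linear (Q : 'M[R]_f) s : linear (@zone_lin Q s).
Proof. by case: s => c x y; exact: ext_lin_is_linear. Qed.

HB.instance Definition _ (Q : 'M[R]_f) s := GRing.isLinear.Build R
  (amb s) (amb s) _ (@zone_lin Q s) (@zone_lin_is_linear Q s).

Lemma ext_lin0 (Q : 'M[R]_f) (M : lmodType R) : ext_lin Q (0 : ext f M) = 0.
Proof. exact: (linear0 (@ext_lin R f f Q M)). Qed.

Lemma zone_diff_natural (Q : 'M[R]_f) (A : 'M[R]_(f, g)) a s t (x : amb s) :
  zone_diff (Q *m A) a t (zone_lin Q x) = zone_lin Q (zone_diff A a t x).
Proof.
case: s x; case: t => x; rewrite /zone_diff /=;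
  try exact/esym/ext_lin0.
- exact: Kos_natural.
- exact: d_mid_low_natural.
- exact: d_high_mid_natural.
exact: eta_natural.
Qed.

Lemma submod_hookL p q : submod (@hookL R g p q).
Proof.
have [N0 ND NZ] := submod_ext_part g p (@submod_degree_part R g q).
split=> [|x y [xN kx] [yN ky]|c x [xN kx]]; split; rewrite ?linear0 //.
- exact: ND.
- by rewrite linearD /= kx ky addr0.
- exact: NZ.
by rewrite linearZ_LR /= kx scaler0.
Qed.

Lemma submod_hookK p q : submod (@hookK R g p q).
Proof.
have [N0 ND NZ] := submod_ext_part g p (@submod_degree_part R g q).
split=> [|x y [xN kx] [yN ky]|c x [xN kx]]; split; rewrite ?linear0 //.
- exact: ND.
- by rewrite linearD /= kx ky addr0.
- exact: NZ.
by rewrite linearZ_LR /= kx scaler0.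
Qed.

Lemma submod_zone_term i a j s : submod (@zone_term i a j s).
Proof.
case: s; apply: submod_ext_part => //; first exact: submod_hookL.
exact: submod_hookK.
Qed.

Lemma zone_lin_term (Q : 'M[R]_f) i a j s x : @zone_term i a j s x -> zone_term i a j (zone_lin Q x).
Proof.
by case: s x => x; apply: ext_lin_part => //; [exact: submod_hookL | exact: submod_hookK].
Qed.

Lemma zone_lin_comp (Q P : 'M[R]_f) s (x : amb s) : zone_lin Q (zone_lin P x) = zone_lin (Q *m P) x.
Proof. by case: s x => x; exact: ext_lin_comp. Qed.

Lemma zone_lin_scalar c i a j s x : @zone_term i a j s x ->
  exists k, zone_lin c%:M x = c ^+ k *: x.
Proof. by case: s x => x; exact: ext_lin_scalar. Qed.

Lemma Phi_basisZ (A : 'M[R]_(f, g)) c l : Phi_basis (c *: A) l = c *: Phi_basis A l.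
Proof.
rewrite /Phi_basis /ext_vect scaler_sumr; apply: eq_bigr => k _.
by rewrite mxE scalerA.
Qed.

Lemma ext_part_hookL r p q (z : ext f (ext g {mpoly R[g]})) :
  ext_part r (hookL p q) z <-> tri r p q z /\ ext_map (@kappa R g) z = 0.
Proof.
split=> [zP|[zt /ffunP kz] S].
  split=> [S|]; first by have := zP S; case: ifP => // _ [].
  apply/ffunP=> S; rewrite !ffunE; have := zP S; case: ifP => [_ [] //|_ ->].
  exact: linear0.
by have := zt S; have := kz S; rewrite !ffunE; case: ifP.
Qed.

Lemma ext_part_hookK r p q (z : ext f (ext g {mpoly R[g]})) :
  ext_part r (hookK p q) z <-> tri r p q z /\ ext_map (@Defs.eta R g) z = 0.
Proof.
split=> [zP|[zt /ffunP kz] S].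
  split=> [S|]; first by have := zP S; case: ifP => // _ [].
  apply/ffunP=> S; rewrite !ffunE; have := zP S; case: ifP => [_ [] //|_ ->].
  exact: linear0.
by have := zt S; have := kz S; rewrite !ffunE; case: ifP.
Qed.

(** Each differential is homogeneous in the entries of the matrix: of degree 1 inside the low and
    high zones, $\mathfrak g+1-a$ and a around the middle. Hence cycles for [x *: E] become cycles
    for E after multiplication by a power of x. *)
Lemma zone_diffZ (A : 'M[R]_(f, g)) c i a j s t (x : amb s) : zone_term i a j x ->
  exists n, zone_diff (c *: A) a t x = c ^+ n *: zone_diff A a t x.
Proof.
case: s x; case: t => x xP; rewrite /zone_diff /=;
  try (by exists 0%N; rewrite scaler0).
- exists 1%N; rewrite expr1 /Kos_Phi scaler_sumr; apply: eq_bigr => l _.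
  by rewrite Phi_basisZ wedgeZr.
- exists (absz (g%:Z + 1 - a)%R); rewrite /d_mid_low scaler_sumr; apply: eq_bigr => T /eqP <-.
  by rewrite ext_PhiZ wedgeZr tensZl.
- exists (absz a); rewrite !d_high_midE scaler_sumr; apply: eq_bigr => T _.
  rewrite ext_PhiZ wedgeZr; have [<- //|Ta] := eqVneq #|T|%:Z a.
  have /ext_part_hookK[xt _] := xP.
  by rewrite (tri_const_coef xt Ta) wedge0l !scaler0.
exists 1%N; rewrite expr1 /eta_Phi scaler_sumr; apply: eq_bigr => l _.
by rewrite Phi_basisZ wedgeZr.
Qed.

End Naturality.

Section Zones.
Variable i : int.

Lemma zone_lowE j : j <= i -> zone_of i j = low.
Proof. by rewrite /zone_of => ->. Qed.

Lemma zone_midE j : j = i + 1 -> zone_of i j = mid.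
Proof. by move=> ->; rewrite /zone_of eqxx gerDl. Qed.

Lemma zone_highE j : i + 2 <= j -> zone_of i j = high.
Proof.
move=> ij; rewrite /zone_of; case: ifP => [|_]; first by lia.
by case: eqP => //; lia.
Qed.

(** The ambient modules depend on the zones, so all occurrences have to be replaced together,
    through the motive P. *)
Lemma zone_ind2 (P : zone -> zone -> Prop) j k : j = k + 1 ->
  (j <= i -> P low low) -> (j = i + 1 -> P mid low) ->
  (j = i + 2 -> P high mid) -> (i + 3 <= j -> P high high) ->
  P (zone_of i j) (zone_of i k).
Proof.
move=> jk Pll Pml Phm Phh; have [ji|ji] := lerP j i.
  by rewrite !zone_lowE //; [exact: Pll | lia].
have [j1|/eqP j1] := eqVneq j (i + 1).
  by rewrite zone_midE // zone_lowE; [exact: Pml | lia].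
have [j2|/eqP j2] := eqVneq j (i + 2).
  by rewrite zone_highE ?zone_midE; [exact: Phm | lia | lia].
by rewrite !zone_highE; [apply: Phh; lia | lia | lia].
Qed.

Lemma zone_ind3 (P : zone -> zone -> zone -> Prop) j k l : j = k + 1 -> k = l + 1 ->
  (j <= i -> P low low low) -> (j = i + 1 -> P mid low low) ->
  (j = i + 2 -> P high mid low) -> (j = i + 3 -> P high high mid) ->
  (i + 4 <= j -> P high high high) ->
  P (zone_of i j) (zone_of i k) (zone_of i l).
Proof.
move=> jk kl Plll Pmll Phml Phhm Phhh.
apply: (@zone_ind2 (fun s t => P s t (zone_of i l)) j k jk) => ji.
- by rewrite zone_lowE; [exact: Plll | lia].
- by rewrite zone_lowE; [exact: Pmll | lia].
- by rewrite zone_lowE; [exact: Phml | lia].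
have [j3|/eqP j3] := eqVneq j (i + 3).
  by rewrite zone_midE; [exact: Phhm | lia].
by rewrite zone_highE; [apply: Phhh; lia | lia].
Qed.

End Zones.

Section HookChain.
Variables (R : comNzRingType) (f g : nat) (i : int) (a : nat).
Hypothesis a_bounds : (0 < a <= g)%N.
Implicit Types (A : 'M[R]_(f, g)).
Notation term j s := (@zone_term R f g i a%:Z j s).
Notation diff A s t := (@zone_diff R f g A a%:Z s t).
Notation zone j := (zone_of i j).

Let b := (g - a)%N.

Let ga : g%:Z - a%:Z = b%:Z.
Proof. by rewrite /b subzn //; case/andP: a_bounds. Qed.

Let gSa : g%:Z + 1 - a%:Z = b.+1%:Z.
Proof. by rewrite addrAC ga intS addrC. Qed.

Let ext_partW r r' (N : R^o -> Prop) (x : ext f R^o) :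
  r = r' -> ext_part r N x -> ext_part r' N x.
Proof. by move->. Qed.

Lemma triW r r' s s' q q' (z : ext f (ext g {mpoly R[g]})) :
  r = r' -> s = s' -> q = q' -> tri r s q z -> tri r' s' q' z.
Proof. by move=> -> -> ->. Qed.

Lemma zone_diff_term A j k : j = k + 1 ->
  forall z, term j (zone j) z -> term k (zone k) (diff A _ (zone k) z).
Proof.
move=> jk.
apply: (@zone_ind2 i (fun s t => forall z, term j s z -> term k t (diff A s t z)) j k jk)
  => ji z /=.
- move/ext_part_hookL => [zt kz]; apply/ext_part_hookL; split.
    by apply: triW (tri_Kos A zt) => //; lia.
  by rewrite -Kos_kappa kz Kos_Phi0.
- move=> zP; apply/ext_part_hookL; rewrite (d_mid_lowE _ _ gSa); split.
    apply: triW (tri_kappa (tri_Psi A b.+1 zP)); rewrite ?ga; lia.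
  exact: ext_map_kappa_sq.
- move/ext_part_hookK => [zt kz].
  by apply: ext_partW (d_high_mid_part A zt); lia.
move/ext_part_hookK => [zt kz]; apply/ext_part_hookK; split.
  by apply: triW (tri_eta_Phi A zt) => //; lia.
by rewrite -eta_Phi_eta kz eta_Phi0.
Qed.

Lemma zone_diff_sq A j k l : j = k + 1 -> k = l + 1 ->
  forall z, term j (zone j) z -> diff A _ (zone l) (diff A _ (zone k) z) = 0.
Proof.
move=> jk kl.
apply: (@zone_ind3 i (fun s t u => forall z, term j s z ->
  diff A t u (diff A s t z) = 0) j k l jk kl) => ji z /=.
- by move=> _; exact: Kos_sq.
- by move=> _; rewrite (d_mid_lowE _ _ gSa); exact: Kos_kappa_Psi.
- move/ext_part_hookK => [zt kz]; rewrite (d_mid_lowE _ _ gSa).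
  by rewrite (Psi_d_high_mid A _ zt) ?kap0 //; case/andP: a_bounds; rewrite /b; lia.
- move/ext_part_hookK => [zt kz]; exact: (d_high_mid_eta_Phi A zt kz).
by move=> _; exact: eta_Phi_sq.
Qed.

Lemma zone_exact (p : 'I_g -> 'I_f) j k l : {homo p : u v / (u < v)%N} ->
  j = k + 1 -> k = l + 1 ->
  forall z, term k (zone k) z -> diff (incl_mx R p) _ (zone l) z = 0 ->
  exists2 y, term j (zone j) y & diff (incl_mx R p) _ (zone k) y = z.
Proof.
move=> p_homo jk kl.
apply: (@zone_ind3 i (fun s t u => forall z, term k t z -> diff (incl_mx R p) t u z = 0 ->
  exists2 y, term j s y & diff (incl_mx R p) s t y = z) j k l jk kl) => ji z /=.
(* The Sym degree at position k is i + 2 - j: at least 2 in this case and equal to 1 in the next. *)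
- rewrite ga => /ext_part_hookL [zt kz] dz.
  have [||y [yt ky dy]] := low_exact p_homo _ _ zt kz dz; [by lia | by lia |].
  exists y => //; apply/ext_part_hookL; split=> //.
  by apply: triW yt => //; lia.
- rewrite ga => /ext_part_hookL [zt kz] dz.
  have {}zt : tri (f%:Z - k) b 1 z by apply: triW zt => //; lia.
  have [x xt kx] := low_mid_exact p_homo zt kz dz.
  exists x; last by rewrite (d_mid_lowE _ _ gSa).
  by apply: ext_partW xt; lia.
- move=> zt; rewrite (d_mid_lowE _ _ gSa) => kz.
  have [||w wt dw] := mid_exact p_homo (k := b.+1) (a := a) _ _ zt kz.
  + by rewrite addSn subnK //; case/andP: a_bounds.
  + by [].
  exists w => //; apply/ext_part_hookK; split; last exact: et_deg0 wt.
  by apply: triW wt => //; lia.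
- move=> /ext_part_hookK [zt ez] dz.
  have q0 : k - i - 2 = 0 by lia.
  have [||y [yt ey dy]] := high_exact p_homo _ zt ez; rewrite ?q0 //.
  exists y => //; apply/ext_part_hookK; split=> //.
  by apply: triW yt => //; lia.
move=> /ext_part_hookK [zt ez] dz.
have [||y [yt ey dy]] := high_exact p_homo _ zt ez; first by lia.
  by rewrite gt_eqF //; lia.
exists y => //; apply/ext_part_hookK; split=> //.
by apply: triW yt => //; lia.
Qed.

Lemma retract_zone_term j : retract (term j (zone j)).
Proof.
have [ji|ji] := lerP j i.
  rewrite zone_lowE //; apply/retract_ext_part/retract_hookL.
  (* Low terms have Sym degree i + 1 - j, at least 1; high terms have exterior degree a, at least 1.
     Both avoid bidegree (0, 0). *)
  by apply/orP; right; lia.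
have [j1|/eqP j1] := eqVneq j (i + 1).
  by rewrite zone_midE //; apply/retract_ext_part/retract_whole.
rewrite zone_highE; last by lia.
apply/retract_ext_part/retract_hookK; apply/orP; left.
by case/andP: a_bounds; lia.
Qed.

Lemma regular_ambient s : regular_module (ambient R f g s).
Proof.
have regN : regular_module (ext f (ext g {mpoly R[g]})).
  exact/regular_ext/regular_ext/regular_mpoly.
by case: s => //; apply: regular_ext => t.
Qed.

Lemma minor_nilpotent A x j k l : is_minor g A x -> j = k + 1 -> k = l + 1 ->
  forall z, term k (zone k) z -> diff A _ (zone l) z = 0 ->
  exists n, exists2 y, term j (zone j) y & diff A _ (zone k) y = x ^+ n *: z.
Proof.
case/split_by_minor=> p [p_homo [Q [P [QE PA QP]]]] jk kl z zt dz.
have zPt := zone_lin_term P zt.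
have [n dn] := zone_diffZ (incl_mx R p) x (zone l) zPt.
have [||y yt dy] := zone_exact p_homo jk kl (z := x ^+ n *: zone_lin P z).
- by case: (submod_zone_term R f g i a k (zone k)) => _ _; apply.
- rewrite linearZ_LR /= -dn -PA zone_diff_natural dz; exact: linear0.
have [m xm] := zone_lin_scalar x zt.
(* The exponent n comes from the homogeneity of the differential, and m from the action of
   $\bigwedge(QP)$ on z. *)
exists (n + m)%N, (zone_lin Q y); first exact: zone_lin_term.
rewrite -QE zone_diff_natural dy linearZ_LR /= zone_lin_comp QP xm.
by rewrite scalerA exprD.
Qed.

Lemma minors_nilpotent A x j k l : minors_ideal g A x -> j = k + 1 -> k = l + 1 ->
  forall z, term k (zone k) z -> diff A _ (zone l) z = 0 ->
  exists n, exists2 y, term j (zone j) y & diff A _ (zone k) y = x ^+ n *: z.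
Proof.
case=> cs csP -> jk kl z zt dz.
pose B (w : ambient R f g (zone k)) := exists2 y, term j (zone j) y & diff A _ (zone k) y = w.
have Bsub : submod B.
  have [t0 tD tZ] := submod_zone_term R f g i a j (zone j).
  split=> [|_ _ [y yt <-] [y' yt' <-]|c _ [y yt <-]].
  - by exists 0; rewrite ?linear0.
  - by exists (y + y'); [exact: tD | exact: linearD].
  by exists (c *: y); [exact: tZ | exact: linearZ_LR].
rewrite big_seq; apply: (big_ind (fun x => exists n, B (x ^+ n *: z))).
(* Exponent 0 would not do, as $0^0=1$. *)
- by exists 1%N; rewrite expr1 scale0r; case: Bsub.
- move=> x1 x2 [n1 B1] [n2 B2]; exists (n1 + n2)%N; exact: radical_submodD.
move=> q /csP qm; have [n Bn] := minor_nilpotent qm jk kl zt dz.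
exists n; rewrite exprMn -scalerA; by case: Bsub => _ _; apply.
Qed.

End HookChain.

Lemma zone_term_eq0 (R : comNzRingType) f g i a j (z : ambient R f g (zone_of i j)) :
  i <= f%:Z - g%:Z -> f%:Z - g%:Z + 1 < j -> zone_term i a j z -> z = 0.
Proof.
move=> ifg Nj; move: z; rewrite zone_highE => [z /ext_part_hookK [zt _]|]; last by lia.
apply: tri_neg zt; apply/orP; right; lia.
Qed.

Theorem corollary8p5 (R : comNzRingType) (noethR : noetherian R)
  (F G : vectType R) (f g : nat) (dimF : dim F = f) (dimG : dim G = g)
  (le_gf : (g <= f)%N)
  (Phi : 'Hom('Hom(G, R^o), F))
  (i a : int) (ha : 1 <= a <= g%:Z) (hi : -1 <= i <= f%:Z - g%:Z)
  (gr : option nat) (hgr : has_grade (minors_ideal g (matrix_of Phi)) gr)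
  (j : int)
  (hj : if gr is Some n then f%:Z - g%:Z + 2 - n%:Z <= j else true) :
  homology_vanishes (matrix_of Phi) i a j.
Proof.
subst f g; case: a ha => // a a_bounds; set A := matrix_of Phi.
have jk : j + 1 = j + 1 by []; have kl : j = (j - 1) + 1 by rewrite subrK.
move=> x xt dx; case: hgr hj => [s _ [sI s_reg _]|I1] hj; last first.
  (* In the unit ideal the element 1 is itself nilpotent on the homology. *)
  have [n [y yt dy]] := minors_nilpotent a_bounds I1 jk kl xt dx.
  by exists y => //; rewrite expr1n scale1r in dy.
pose M j := ambient R (dim F) (dim G) (zone_of i j).
pose C j : M j -> Prop := zone_term i a%:Z j (s := zone_of i j).
pose d j k : M j -> M k := zone_diff A a%:Z (zone_of i k).
have Creg l : wreg (@C l) (catrev s [::]).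
  apply: wreg_retract (regular_seq_wreg s_reg); first exact: regular_ambient.
  exact: retract_zone_term.
suff [y [c [yt -> xE]]] : bounds C d (j + 1) [::] x by exists y => //; rewrite xE addr0.
(* The last position that can carry a nonzero term is $\mathfrak f-\mathfrak g+1$; subtracting the
   length of s, the strict inequality required of j is exactly [hj]. *)
apply: (@acyclic_mod R M C d ((dim F)%:Z - (dim G)%:Z + 1) (minors_ideal (dim G) A)
  _ _ _ _ _ _ s [::] sI Creg (j + 1) j (j - 1)) => //.
- by move=> k; exact: submod_zone_term.
- by move=> k l; exact: zone_diff_is_linear.
- by move=> k l kl' z; exact: (zone_diff_term a_bounds A kl').
- by move=> k l m kl' lm z; exact: (zone_diff_sq a_bounds A kl' lm).
- by move=> k z Nk; apply: zone_term_eq0; case/andP: hi.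
- by move=> y Iy k l m kl' lm z zt dz; exact: (minors_nilpotent a_bounds Iy kl' lm zt dz).
by move: hj; set u := (dim F)%:Z; set v := (dim G)%:Z; set w := (size s)%:Z => hj; lia.
Qed.
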